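(* Let $\mathfrak{D}$ be a rooted diagram all of whose undirected cycles pass through its root, and let $\mathcal{C}=\{\mathfrak{F}\mid\mathfrak{F}\models\forall x_0\,\mathsf{e}^{\mathfrak{D}}(x_0)\}$. Then all of the following hold: (I-i) $\mathsf{e}^{\mathfrak{D}}(x_0)$ is locally modally definable by a generalised Sahlqvist formula; (I-ii) $\mathsf{e}^{\mathfrak{D}}(x_0)$ is locally modally definable; (I-iii) $\forall x_0\mathsf{e}^{\mathfrak{D}}(x_0)$ is globally modally definable; (I-iv) $\mathrm{Log}(\mathcal{C})$ is axiomatisable by a single generalised Sahlqvist formula; (I-v) $\mathrm{Log}(\mathcal{C})$ is finitely axiomatisable; (I-vi) $\mathrm{Log}(\mathcal{C})$ is axiomatisable by a set of formulas containing only finitely many propositional variables; (I-vii) $\mathrm{Log}(\mathcal{C})$ is axiomatisable by a set of canonical formulas; (I-viii) $\mathrm{Log}(\mathcal{C})$ is axiomatisable by one modal formula together with a set of canonical formulas; (I-ix) $\{\mathfrak{F}\mid\mathfrak{F}\models\mathrm{Log}(\mathcal{C})\}=\mathcal{C}$; (I-x) $\{\mathfrak{F}\mid\mathfrak{F}\models\mathrm{Log}(\mathcal{C})\}$ is definable by a single first-order sentence.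
   Context: Kripke frames $(W,(R_\lambda)_{\lambda\in\Lambda})$. A diagram is a finite pointed frame $\mathfrak{D}=(\{x_0,\dots,x_n\},(R^{\mathfrak{D}}_\lambda),x_0)$, rooted meaning every point is reachable from $x_0$ by a directed path; $\mathsf{e}^{\mathfrak{D}}(x_0)=\exists x_1\dots\exists x_n\bigwedge\{x_iR_\lambda x_j\mid x_iR^{\mathfrak{D}}_\lambda x_j\}$. An undirected cycle is a closed path of positive length whose steps follow edges forwards or backwards, without immediate backtracking along the same edge. A first-order formula $\mathsf{a}(x)$ is locally modally definable (by $\phi$) if for every frame $\mathfrak{F}$ and point $w$: $\mathfrak{F},w\models\phi$ (valid at $w$ under all valuations) iff $\mathfrak{F}\models\mathsf{a}(w)$; a sentence $\mathsf{a}$ is globally modally definable if for some $\phi$, $\mathfrak{F}\models\phi\iff\mathfrak{F}\models\mathsf{a}$ for all frames. Generalised Sahlqvist formulas are in the sense of Goranko–Vakarelov. $\mathrm{Log}(\mathcal{C})$ is the set of modal formulas valid on all frames of $\mathcal{C}$; axiomatisable means equal to the least normal modal logic containing the given set; a formula $\phi$ is canonical if valid on the canonical frame of $\mathsf{K}+\phi$. *)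

(* Defs.v *)
From Stdlib Require Import List Arith Relations.
Import ListNotations.
Set Implicit Arguments.

Section Defs.
Variable Lam : Type.

Record frame := Frame { W : Type; R : Lam -> W -> W -> Prop }.

Inductive form :=
| Var (p : nat) | Top | Bot
| Neg (f : form) | And (f g : form) | Or (f g : form) | Imp (f g : form)
| Box (l : Lam) (f : form) | Dia (l : Lam) (f : form).

Fixpoint sat {F : frame} (V : nat -> W F -> Prop) (w : W F) (f : form) : Prop :=
  match f with
  | Var p => V p w
  | Top => True
  | Bot => False
  | Neg f => ~ sat V w f
  | And f g => sat V w f /\ sat V w g
  | Or f g => sat V w f \/ sat V w g
  | Imp f g => sat V w f -> sat V w g
  | Box l f => forall v, R F l w v -> sat V v f
  | Dia l f => exists v, R F l w v /\ sat V v f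
  end.

Definition valid_at (F : frame) (w : W F) (f : form) : Prop := forall V, sat V w f.
Definition frame_valid (F : frame) (f : form) : Prop := forall w, valid_at F w f.

Definition frame_class := frame -> Prop.
Definition Log (C : frame_class) (f : form) : Prop := forall F, C F -> frame_valid F f.
Definition validates (F : frame) (L : form -> Prop) : Prop := forall f, L f -> frame_valid F f.

Fixpoint pol (b : bool) (f : form) (q : nat) : Prop :=
  match f with
  | Var p => b = true /\ p = q
  | Top | Bot => False
  | Neg f => pol (negb b) f q
  | And f g | Or f g => pol b f q \/ pol b g q
  | Imp f g => pol (negb b) f q \/ pol b g q
  | Box _ f | Dia _ f => pol b f q
  end.
Definition occurs (q : nat) (f : form) : Prop := pol true f q \/ pol false f q.
Definition positive (f : form) : Prop := forall q, ~ pol false f q.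
Definition negative (f : form) : Prop := forall q, ~ pol true f q.

(* ---------- generalised Sahlqvist (inductive) formulas, Goranko--Vakarelov ---------- *)
(* dep q p : the dependency digraph is allowed to contain the edge q -> p.
   boxform dep p B : B is a box-form with head p, i.e.
   B = □..(A1 -> □..(A2 -> ... □..(An -> p))) with the Ai positive, and
   every variable q occurring in some Ai yields an edge q -> p of the digraph. *)
Inductive boxform (dep : nat -> nat -> Prop) (p : nat) : form -> Prop :=
| bf_var : boxform dep p (Var p)
| bf_box : forall l B, boxform dep p B -> boxform dep p (Box l B)
| bf_imp : forall A B, positive A -> (forall q, occurs q A -> dep q p) ->
    boxform dep p B -> boxform dep p (Imp A B).

(* regular formulas: built from positive formulas and negated box-forms by ∧, ∨, □.
   coreg collects the formulas whose negation is (equivalent to) regular in the obvious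
   syntactic way, so that implicational presentations (antecedent -> consequent) are
   also covered. *)
Inductive reg (dep : nat -> nat -> Prop) : form -> Prop :=
| reg_pos : forall P, positive P -> reg dep P
| reg_neg : forall X, coreg dep X -> reg dep (Neg X)
| reg_imp : forall X Y, coreg dep X -> reg dep Y -> reg dep (Imp X Y)
| reg_and : forall X Y, reg dep X -> reg dep Y -> reg dep (And X Y)
| reg_or : forall X Y, reg dep X -> reg dep Y -> reg dep (Or X Y)
| reg_box : forall l X, reg dep X -> reg dep (Box l X)
with coreg (dep : nat -> nat -> Prop) : form -> Prop :=
| coreg_bf : forall p B, boxform dep p B -> coreg dep B
| coreg_negf : forall N, negative N -> coreg dep N
| coreg_neg : forall X, reg dep X -> coreg dep (Neg X)
| coreg_and : forall X Y, coreg dep X -> coreg dep Y -> coreg dep (And X Y)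
| coreg_or : forall X Y, coreg dep X -> coreg dep Y -> coreg dep (Or X Y)
| coreg_dia : forall l X, coreg dep X -> coreg dep (Dia l X).

Definition gen_sahlqvist (f : form) : Prop :=
  exists dep : nat -> nat -> Prop,
    (forall p, ~ clos_trans nat dep p p) /\ reg dep f.

Fixpoint beval (v : form -> bool) (f : form) : bool :=
  match f with
  | Var _ | Box _ _ | Dia _ _ => v f
  | Top => true
  | Bot => false
  | Neg f => negb (beval v f)
  | And f g => beval v f && beval v g
  | Or f g => beval v f || beval v g
  | Imp f g => implb (beval v f) (beval v g)
  end.
Definition tautology (f : form) : Prop := forall v, beval v f = true.

Fixpoint subst (s : nat -> form) (f : form) : form :=
  match f with
  | Var p => s p
  | Top => Top
  | Bot => Bot
  | Neg f => Neg (subst s f)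
  | And f g => And (subst s f) (subst s g)
  | Or f g => Or (subst s f) (subst s g)
  | Imp f g => Imp (subst s f) (subst s g)
  | Box l f => Box l (subst s f)
  | Dia l f => Dia l (subst s f)
  end.

Inductive Deriv (G : form -> Prop) : form -> Prop :=
| d_ax : forall f, G f -> Deriv G f
| d_taut : forall f, tautology f -> Deriv G f
| d_K : forall l f g, Deriv G (Imp (Box l (Imp f g)) (Imp (Box l f) (Box l g)))
| d_dual1 : forall l f, Deriv G (Imp (Dia l f) (Neg (Box l (Neg f))))
| d_dual2 : forall l f, Deriv G (Imp (Neg (Box l (Neg f))) (Dia l f))
| d_mp : forall f g, Deriv G (Imp f g) -> Deriv G f -> Deriv G g
| d_nec : forall l f, Deriv G f -> Deriv G (Box l f)
| d_sub : forall s f, Deriv G f -> Deriv G (subst s f).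

Definition axiomatises (G : form -> Prop) (L : form -> Prop) : Prop :=
  forall f, L f <-> Deriv G f.

Definition conj (l : list form) : form := fold_right And Top l.
Definition consistent (L : form -> Prop) (S : form -> Prop) : Prop :=
  ~ exists l, Forall S l /\ L (Imp (conj l) Bot).
Definition mcs (L : form -> Prop) (S : form -> Prop) : Prop :=
  consistent L S /\ forall f, S f \/ S (Neg f).
Definition canonical_frame (L : form -> Prop) : frame :=
  @Frame {S : form -> Prop | mcs L S}
    (fun l S T => forall f, proj1_sig S (Box l f) -> proj1_sig T f).
Definition canonical (f : form) : Prop :=
  frame_valid (canonical_frame (Deriv (fun g => g = f))) f.

Inductive fo :=
| FR (l : Lam) (i j : nat) | FEq (i j : nat) | FTrue | FFalse
| FNot (a : fo) | FAnd (a b : fo) | FOr (a b : fo) | FImp (a b : fo)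
| FAll (i : nat) (a : fo) | FEx (i : nat) (a : fo).

Definition upd {X : Type} (g : nat -> X) (i : nat) (d : X) : nat -> X :=
  fun k => if Nat.eqb k i then d else g k.

Fixpoint fo_sat {F : frame} (g : nat -> W F) (a : fo) : Prop :=
  match a with
  | FR l i j => R F l (g i) (g j)
  | FEq i j => g i = g j
  | FTrue => True
  | FFalse => False
  | FNot a => ~ fo_sat g a
  | FAnd a b => fo_sat g a /\ fo_sat g b
  | FOr a b => fo_sat g a \/ fo_sat g b
  | FImp a b => fo_sat g a -> fo_sat g b
  | FAll i a => forall d, fo_sat (upd g i d) a
  | FEx i a => exists d, fo_sat (upd g i d) a
  end.

Fixpoint fv (a : fo) (k : nat) : Prop :=
  match a with
  | FR _ i j | FEq i j => k = i \/ k = j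
  | FTrue | FFalse => False
  | FNot a => fv a k
  | FAnd a b | FOr a b | FImp a b => fv a k \/ fv b k
  | FAll i a | FEx i a => k <> i /\ fv a k
  end.
Definition sentence (a : fo) : Prop := forall k, ~ fv a k.

(* F |= a(w), for a formula a(x0) whose free variable is x0 (= variable 0) *)
Definition holds_at (F : frame) (a : fo) (w : W F) : Prop :=
  forall g : nat -> W F, g 0 = w -> fo_sat g a.
Definition fo_valid (F : frame) (a : fo) : Prop := forall g : nat -> W F, fo_sat g a.

Definition loc_def_by (a : fo) (f : form) : Prop :=
  forall (F : frame) (w : W F), valid_at F w f <-> holds_at F a w.
Definition loc_definable (a : fo) : Prop := exists f, loc_def_by a f.
Definition glob_definable (a : fo) : Prop :=
  exists f, forall F : frame, frame_valid F f <-> fo_valid F a.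

(* a diagram with points x_0, ..., x_n (x_i represented by i) and finitely many edges
   (l, i, j) meaning x_i R_l x_j; the root is x_0 *)
Record diagram := Diagram { dn : nat; dedges : list (Lam * nat * nat) }.

Definition diag_wf (D : diagram) : Prop :=
  forall l i j, In (l, i, j) (dedges D) -> i <= dn D /\ j <= dn D.

Inductive reach (D : diagram) : nat -> Prop :=
| reach0 : reach D 0
| reachS : forall l i j, reach D i -> In (l, i, j) (dedges D) -> reach D j.

Definition rooted (D : diagram) : Prop := forall i, i <= dn D -> reach D i.

Definition step_ok (D : diagram) (u : nat) (s : (Lam * nat * nat) * bool) (v : nat) : Prop :=
  In (fst s) (dedges D) /\
  match fst s with
  | (_, a, b) => if snd s then a = u /\ b = v else b = u /\ a = v
  end.

(* undirected cycle of length k >= 1 through vertices vx 0, ..., vx k = vx 0 along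
   steps st 0, ..., st (k-1), without immediately traversing the same edge back *)
Definition undirected_cycle (D : diagram) (k : nat) (vx : nat -> nat)
    (st : nat -> (Lam * nat * nat) * bool) : Prop :=
  1 <= k /\ vx k = vx 0 /\
  (forall i, i < k -> step_ok D (vx i) (st i) (vx (S i))) /\
  (forall i, S i < k -> ~ (fst (st i) = fst (st (S i)) /\ snd (st i) <> snd (st (S i)))).

Definition cycles_through_root (D : diagram) : Prop :=
  forall k vx st, undirected_cycle D k vx st -> exists i, i <= k /\ vx i = 0.

Definition diag_formula (D : diagram) : fo :=
  fold_right (fun i a => FEx i a)
    (fold_right (fun e a => match e with (l, i, j) => FAnd (FR l i j) a end) FTrue (dedges D))
    (seq 1 (dn D)).

End Defs.

Arguments Var {Lam}. Arguments Top {Lam}. Arguments Bot {Lam}.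
Arguments FTrue {Lam}. Arguments FFalse {Lam}.

(* Main.v *)
Require Import Defs.
From mathcomp Require classical_sets.
From Stdlib Require Import List Arith Relations Lia Classical ClassicalEpsilon.
From Stdlib Require Import FunctionalExtensionality PropExtensionality ProofIrrelevance.
Import ListNotations.

(** Off its root the diagram is a forest.  Rootedness makes every edge pointing into a vertex
    [v] of a tree start either at the root or in a subtree that is itself reachable from the
    root, so the set of possible values of [v] is built from the root by forward steps,
    intersections and diamonds.  Backward steps out of a reachable subtree are expressed by
    fresh variables: the minimal valuation satisfying a box-form evaluated at the root is
    exactly the set of end points of a walk whose stations satisfy given positive conditions.
    The same induction gives canonicity: in a saturated model, if all definable valuations
    satisfying the box-forms satisfy the positive consequent, compactness and tightness
    provide the points required by the first-order condition. *)

(** * Box-forms and their minimal valuations *)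

Set Implicit Arguments.

Section Modal.
Variable Lam : Type.
Implicit Types (F : frame Lam) (A f g : form Lam).

(** Deleting an edge between two non-root points leaves its ends unconnected off the root, so once
    the values of the two ends are fixed both sides can be assigned independently; this is what
    reduces a jointly quantified condition to predicates of a single point. The root may be shared
    by all parts, since its value is the evaluation point and is never chosen, and this is why
    cycles through it do no harm.

    In the canonical model the minimal valuation need not be given by formulas, so the
    correspondence argument cannot be repeated there verbatim. The induction therefore carries two
    invariants side by side: one about the minimal valuation on an arbitrary frame, the other about
    all substitutions that make the box-forms true in a saturated model. In the second one a point
    is approximated by a family of formulas, which must be directed for compactness to apply;
    positivity of the box-forms provides this. *)

Lemma sat_mono_pol F f : forall (V V' : nat -> W F -> Prop),
  (forall q, pol true f q -> forall x, V q x -> V' q x) ->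
  (forall q, pol false f q -> forall x, V' q x -> V q x) ->
  forall x, sat V x f -> sat V' x f.
Proof.
  induction f; simpl; intros V V' Hp Hn x; auto.
  - intros H H1. apply H. revert H1. apply IHf; auto.
  - intros [H1 H2]. split; [revert H1; apply IHf1 | revert H2; apply IHf2]; auto.
  - intros [H1|H2]; [left; revert H1; apply IHf1 | right; revert H2; apply IHf2]; auto.
  - intros H H1. apply (IHf2 V V'); auto. apply H. revert H1. apply IHf1; auto.
  - intros H v Hv. apply (IHf V V'); auto.
  - intros [v [Hv H]]. exists v. split; auto. apply (IHf V V'); auto.
Qed.

Lemma sat_subst F (V : nat -> W F -> Prop) s f : forall x,
  sat V x (subst s f) <-> sat (fun p y => sat V y (s p)) x f.
Proof.
  induction f; simpl; intros x; try tauto.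
  - rewrite IHf. tauto.
  - rewrite IHf1, IHf2. tauto.
  - rewrite IHf1, IHf2. tauto.
  - rewrite IHf1, IHf2. tauto.
  - split; intros H v Hv; apply IHf; auto.
  - split; intros [v [Hv H]]; exists v; split; auto; apply IHf; auto.
Qed.

Definition positive_below (n : nat) (A : form Lam) : Prop :=
  positive A /\ forall q, occurs q A -> q < n.

Lemma sat_mono_below F n A (V V' : nat -> W F -> Prop) :
  positive_below n A ->
  (forall q, q < n -> forall x, V q x -> V' q x) ->
  forall x, sat V x A -> sat V' x A.
Proof.
  intros [Hp Hb] H. apply sat_mono_pol.
  - intros q Hq. apply H, Hb. left. exact Hq.
  - intros q Hq. destruct (Hp q Hq).
Qed.

Lemma positive_below_weaken n m A : n <= m -> positive_below n A -> positive_below m A.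
Proof. intros Hnm [H1 H2]. split; auto. intros q Hq. specialize (H2 q Hq). lia. Qed.

(* A context is a box-form with its head removed, read inside out. *)
Inductive ctx : Type :=
| Hole
| CImp (c : ctx) (A : form Lam)
| CBox (c : ctx) (l : Lam).

Fixpoint fill (c : ctx) (f : form Lam) : form Lam :=
  match c with
  | Hole => f
  | CImp c A => fill c (Imp A f)
  | CBox c l => fill c (Box l f)
  end.

(** The least possible value of the head: by [sat_fill] the box-form holds at [w] exactly when its
    head holds throughout this set. *)
Fixpoint pts {F : frame Lam} (V : nat -> W F -> Prop) (w : W F) (c : ctx) (z : W F) : Prop :=
  match c with
  | Hole => z = w
  | CImp c A => pts V w c z /\ sat V z A
  | CBox c l => exists y, pts V w c y /\ R F l y z
  end.

Fixpoint ctx_below (n : nat) (c : ctx) : Prop :=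
  match c with
  | Hole => True
  | CImp c A => ctx_below n c /\ positive_below n A
  | CBox c _ => ctx_below n c
  end.

Lemma sat_fill F (V : nat -> W F -> Prop) w c : forall f,
  sat V w (fill c f) <-> forall z, pts V w c z -> sat V z f.
Proof.
  induction c as [|c IH A|c IH l]; simpl; intros f.
  - split; [intros H z ->; exact H | auto].
  - rewrite IH. simpl. firstorder.
  - rewrite IH. simpl. firstorder.
Qed.

Lemma pts_mono F n c (V V' : nat -> W F -> Prop) w :
  ctx_below n c -> (forall q, q < n -> forall x, V q x -> V' q x) ->
  forall z, pts V w c z -> pts V' w c z.
Proof.
  intros Hc H. induction c as [|c IH A|c IH l]; simpl in *; intros z.
  - auto.
  - destruct Hc as [Hc HA]. intros [H1 H2]. split; [auto|]. revert H2.
    apply sat_mono_below with n; auto.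
  - intros [y [H1 H2]]. exists y. auto.
Qed.

Lemma ctx_below_weaken n m c : n <= m -> ctx_below n c -> ctx_below m c.
Proof.
  intros Hnm. induction c; simpl; auto. intros [H1 H2]; split; auto.
  apply positive_below_weaken with n; auto.
Qed.

Lemma fill_boxform p c : forall B, ctx_below p c -> boxform lt p B -> boxform lt p (fill c B).
Proof.
  induction c as [|c IH A|c IH l]; simpl; intros B Hc HB; auto.
  - apply IH; [tauto|]. destruct Hc as [_ [H1 H2]]. constructor; auto.
  - apply IH; auto. constructor; auto.
Qed.

(* The variable [i] is constrained by the box-form [fill c (Var i)], where [c] is the
   [i]-th context of the environment. *)
Definition env := list ctx.
Definition env_wf (G : env) : Prop := forall i c, nth_error G i = Some c -> ctx_below i c.

Definition good {F : frame Lam} (G : env) (w : W F) (V : nat -> W F -> Prop) : Prop :=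
  forall i c, nth_error G i = Some c -> forall z, pts V w c z -> V i z.
Definition exact {F : frame Lam} (G : env) (w : W F) (V : nat -> W F -> Prop) : Prop :=
  forall i c, nth_error G i = Some c -> forall z, V i z <-> pts V w c z.

Lemma nth_error_lt {X} (G : list X) i : i < length G -> exists c, nth_error G i = Some c.
Proof.
  intros H. destruct (nth_error G i) eqn:E; eauto.
  apply nth_error_None in E. lia.
Qed.

Lemma exact_least F G (w : W F) V V' : env_wf G -> exact G w V -> good G w V' ->
  forall i, i < length G -> forall x, V i x -> V' i x.
Proof.
  intros HG HV HV' i. induction i as [i IH] using lt_wf_ind. intros Hi x Hx.
  destruct (nth_error_lt G Hi) as [c Hc].
  apply (HV' _ _ Hc). apply (HV _ _ Hc) in Hx. revert Hx.
  apply pts_mono with i; [apply HG; auto|]. intros q Hq. apply IH; auto. lia.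
Qed.

(** The equations in [exact] mention [V] on both sides, but the context at position [i] reads only
    variables below [i], so the values can be fixed one position at a time. *)
Lemma exact_exists F G (w : W F) : env_wf G -> exists V, exact G w V.
Proof.
  induction G as [|c G IH] using rev_ind; intros HG.
  - exists (fun _ _ => True). intros i c H. destruct i; discriminate.
  - destruct IH as [V HV].
    { intros i d H. apply HG. rewrite nth_error_app1; auto. apply nth_error_Some. congruence. }
    set (V' := fun q => if q =? length G then pts V w c else V q).
    assert (E : forall q, q < length G -> V' q = V q).
    { intros q Hq. unfold V'. destruct (Nat.eqb_spec q (length G)); auto. lia. }
    exists V'. intros i d Hi z.
    assert (Hd := HG _ _ Hi).
    destruct (Nat.lt_total i (length G)) as [L|[L|L]].
    + rewrite nth_error_app1 in Hi by auto. rewrite E by auto.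
      rewrite (HV _ _ Hi z).
      split; apply pts_mono with i; auto; intros q Hq x; rewrite E; auto; lia.
    + subst i. rewrite nth_error_app2, Nat.sub_diag in Hi by lia. injection Hi as <-.
      unfold V' at 1. rewrite Nat.eqb_refl.
      split; apply pts_mono with (length G); auto; intros q Hq x; rewrite E; auto.
    + rewrite (proj2 (nth_error_None _ _)) in Hi; [discriminate|]. rewrite length_app. simpl. lia.
Qed.

Lemma exact_good F G (w : W F) V : exact G w V -> good G w V.
Proof. intros H i c Hc z. apply (H i c Hc). Qed.

Lemma nth_error_app_l {X} (G H : list X) i c :
  nth_error G i = Some c -> nth_error (G ++ H) i = Some c.
Proof. intros E. rewrite nth_error_app1; auto. apply nth_error_Some. congruence. Qed.

Lemma exact_prefix F G H (w : W F) V : exact (G ++ H) w V -> exact G w V.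
Proof. intros E i c Hc. apply E. apply nth_error_app_l, Hc. Qed.

(* With [b = true] only predicates are generated that can be reached from [w] along
   forward steps; these are the ones that a box-form evaluated at [w] can capture. *)
Inductive walk_def : bool -> (forall F : frame Lam, W F -> W F -> Prop) -> Prop :=
| wd_root : walk_def true (fun F w v => v = w)
| wd_step l P : walk_def true P -> walk_def true (fun F w v => exists z, P F w z /\ R F l z v)
| wd_and b P Q : walk_def b P -> walk_def false Q -> walk_def b (fun F w v => P F w v /\ Q F w v)
| wd_top : walk_def false (fun F w v => True)
| wd_dia l P : walk_def false P -> walk_def false (fun F w v => exists z, R F l v z /\ P F w z)
| wd_weaken P : walk_def true P -> walk_def false P
| wd_ext b (P Q : forall F : frame Lam, W F -> W F -> Prop) :
    (forall F w v, P F w v <-> Q F w v) -> walk_def b P -> walk_def b Q.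

(** Compactness, tightness and differentiation of the descriptive frame formed by the sets definable
    under [V]. *)
Definition saturated {F : frame Lam} (V : nat -> W F -> Prop) : Prop :=
  (forall S : form Lam -> Prop,
     (forall L, Forall S L -> exists x, Forall (sat V x) L) ->
     exists x, forall f, S f -> sat V x f) /\
  (forall l x y, (forall f, sat V x (Box l f) -> sat V y f) -> R F l x y) /\
  (forall x y, (forall f, sat V x f -> sat V y f) -> x = y).

Definition sval {F : frame Lam} (V : nat -> W F -> Prop) (s : nat -> form Lam) :
  nat -> W F -> Prop := fun p x => sat V x (s p).

(** * Directed families of formulas in saturated models *)

Section Saturated.
Variables (F : frame Lam) (V : nat -> W F -> Prop).
Hypothesis Hsat : saturated V.

Definition directed (S : form Lam -> Prop) : Prop :=
  (exists f, S f) /\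
  forall f g, S f -> S g -> exists h, S h /\ forall x, sat V x h -> sat V x f /\ sat V x g.

(** Having a successor commutes with directed intersections. Compactness is applied to [S] together
    with all [f] for which [Box l f] holds at [v]; tightness then makes the point found a successor
    of [v]. *)
Lemma directed_forward S l v : directed S ->
  (forall f, S f -> exists y, R F l v y /\ sat V y f) ->
  exists y, R F l v y /\ forall f, S f -> sat V y f.
Proof.
  intros HS H. destruct Hsat as [Hc [Ht _]].
  destruct (Hc (fun f => S f \/ sat V v (Box l f))) as [y Hy].
  - intros L HL.
    enough (exists h, S h /\ forall y, R F l v y -> sat V y h -> Forall (sat V y) L) as [h [Hh Hh']].
    { destruct (H h Hh) as [y [Hy Hy']]. exists y. auto. }
    induction HL as [|f L Hf _ [h [Hh Hh']]].
    + destruct HS as [[f0 H0] _]. exists f0. auto.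
    + destruct Hf as [Hf|Hf].
      * destruct (proj2 HS f h Hf Hh) as [k [Hk Hk']]. exists k. split; auto.
        intros y Hy Hy'. destruct (Hk' y Hy'). auto.
      * exists h. split; auto.
  - exists y. split.
    + apply Ht. intros f Hf. apply Hy. auto.
    + intros f Hf. apply Hy. auto.
Qed.

(** The counterpart for predecessors: it suffices that [v] lies in every definable set containing
    all successors of some member of [S]. The point sought must satisfy [S] and refute [Box l g] for
    each [g] false at [v]. *)
Lemma directed_backward S l v : directed S ->
  (forall f g, S f -> (forall y, sat V y f -> sat V y (Box l g)) -> sat V v g) ->
  exists y, R F l y v /\ forall f, S f -> sat V y f.
Proof.
  intros HS H. destruct Hsat as [Hc [Ht _]].
  destruct (Hc (fun f => S f \/ exists g, f = Neg (Box l g) /\ ~ sat V v g)) as [y Hy].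
  - intros L HL.
    enough (exists h g, S h /\ ~ sat V v g /\
              forall y, sat V y h -> ~ sat V y (Box l g) -> Forall (sat V y) L)
      as [h [g [Hh [Hg Hh']]]].
    { apply NNPP. intros Hn. apply Hg. apply (H h g Hh). intros y Hy.
      apply NNPP. intros Hy'. apply Hn. exists y. auto. }
    induction HL as [|f L Hf _ [h [g [Hh [Hg Hh']]]]].
    + destruct HS as [[f0 H0] _]. exists f0, Bot. simpl. auto.
    + destruct Hf as [Hf|[g' [-> Hg']]].
      * destruct (proj2 HS f h Hf Hh) as [k [Hk Hk']]. exists k, g. split; auto. split; auto.
        intros y Hy Hy'. destruct (Hk' y Hy). auto.
      (* Finitely many refutations follow from one: where [Box l (Or g g')] fails, both [Box l g]
         and [Box l g'] fail. *)
      * exists h, (Or g g'). split; auto. split; [simpl; tauto|].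
        intros y Hy Hy'. simpl in Hy'. constructor.
        -- simpl. intros H1. apply Hy'. intros u Hu. right. auto.
        -- apply Hh'; auto.
  - exists y. split.
    + apply Ht. intros f Hf. apply NNPP. intros Hn.
      apply (Hy (Neg (Box l f))); eauto.
    + intros f Hf. apply Hy. auto.
Qed.

Lemma good_top G w : good G w (sval V (fun _ => Top)).
Proof. intros i c _ z _. exact I. Qed.

(** Contexts are positive, so a smaller valuation has a smaller [pts]; this closes the good
    substitutions under conjunction. *)
Lemma good_meet G w s1 s2 : env_wf G -> good G w (sval V s1) -> good G w (sval V s2) ->
  good G w (sval V (fun p => And (s1 p) (s2 p))).
Proof.
  intros HG H1 H2 i c Hc z Hz. split.
  - apply (H1 i c Hc). revert Hz. apply pts_mono with i; [apply HG; auto|].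
    intros q _ x [Hx _]. exact Hx.
  - apply (H2 i c Hc). revert Hz. apply pts_mono with i; [apply HG; auto|].
    intros q _ x [_ Hx]. exact Hx.
Qed.

(* Above the prefix every variable may be sent to [Top]. *)
Lemma good_extend G H w s : env_wf (G ++ H) -> good G w (sval V s) ->
  exists s', good (G ++ H) w (sval V s') /\ forall q, q < length G -> s' q = s q.
Proof.
  intros HG Hs. exists (fun q => if q <? length G then s q else Top). split.
  - intros i c Hc z Hz. unfold sval. destruct (Nat.ltb_spec i (length G)) as [L|L]; simpl; auto.
    assert (Hb := HG _ _ Hc).
    rewrite nth_error_app1 in Hc by auto. apply (Hs _ _ Hc). revert Hz.
    apply pts_mono with i; auto. intros q Hq x. unfold sval.
    destruct (Nat.ltb_spec q (length G)); auto. lia.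
  - intros q Hq. destruct (Nat.ltb_spec q (length G)); auto. lia.
Qed.

(** These formulas are the definable upper bounds of [X] at good substitutions. As [X] is monotone,
    the conjunction of two substitutions serves both of their bounds. *)
Lemma directed_good G w (X : (nat -> W F -> Prop) -> W F -> Prop) :
  env_wf G ->
  (forall V1 V2 : nat -> W F -> Prop, (forall q, q < length G -> forall x, V1 q x -> V2 q x) ->
     forall x, X V1 x -> X V2 x) ->
  directed (fun f => exists s, good G w (sval V s) /\ forall x, X (sval V s) x -> sat V x f).
Proof.
  intros HG HX. split.
  - exists Top, (fun _ => Top). split; [apply good_top | simpl; auto].
  - intros f g [s1 [G1 H1]] [s2 [G2 H2]].
    exists (And f g). split; [|simpl; auto].
    exists (fun p => And (s1 p) (s2 p)). split; [apply good_meet; auto|].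
    intros x Hx. split.
    + apply H1. revert Hx. apply HX. intros q _ y [Hy _]. exact Hy.
    + apply H2. revert Hx. apply HX. intros q _ y [_ Hy]. exact Hy.
Qed.
End Saturated.

(** * Predicates captured by formulas and contexts *)

Definition captures_form (G : env) (A : form Lam) (Q : forall F : frame Lam, W F -> W F -> Prop) :=
  positive_below (length G) A /\
  (forall F w V, exact G w V -> forall v, sat V v A <-> Q F w v) /\
  (forall F (V : nat -> W F -> Prop), saturated V -> forall w v,
     (forall s, good G w (sval V s) -> sat (sval V s) v A) -> Q F w v).

(** In both notions the second clause yields correspondence and the third canonicity. A context has
    no truth value at [v]; its third clause asks instead that [v] belong to every definable set that
    includes [pts] at some good substitution. *)
Definition captures_ctx (G : env) (c : ctx) (P : forall F : frame Lam, W F -> W F -> Prop) :=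
  ctx_below (length G) c /\
  (forall F w V, exact G w V -> forall v, pts V w c v <-> P F w v) /\
  (forall F (V : nat -> W F -> Prop), saturated V -> forall w v,
     (forall s f, good G w (sval V s) ->
        (forall z, pts (sval V s) w c z -> sat V z f) -> sat V v f) -> P F w v).

Lemma captures_form_extend G H A Q : env_wf (G ++ H) ->
  captures_form G A Q -> captures_form (G ++ H) A Q.
Proof.
  intros HG [H1 [H2 H3]]. split; [|split].
  - apply positive_below_weaken with (length G); auto. rewrite length_app. lia.
  - intros F w V HV. apply H2. revert HV. apply exact_prefix.
  - intros F V HV w v H0. apply (H3 F V HV). intros s Hs.
    destruct (good_extend H HG Hs) as [s' [Hs' E]].
    generalize (H0 s' Hs'). apply sat_mono_below with (length G); auto.
    intros q Hq x. unfold sval. rewrite E; auto.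
Qed.

Lemma captures_ctx_extend G H c P : env_wf (G ++ H) ->
  captures_ctx G c P -> captures_ctx (G ++ H) c P.
Proof.
  intros HG [H1 [H2 H3]]. split; [|split].
  - apply ctx_below_weaken with (length G); auto. rewrite length_app. lia.
  - intros F w V HV. apply H2. revert HV. apply exact_prefix.
  - intros F V HV w v H0. apply (H3 F V HV). intros s f Hs Hf.
    destruct (good_extend H HG Hs) as [s' [Hs' E]].
    apply (H0 s' f Hs'). intros z Hz. apply Hf. revert Hz.
    apply pts_mono with (length G); auto. intros q Hq x. unfold sval. rewrite E; auto.
Qed.

Lemma captures_ctx_root G : captures_ctx G Hole (fun F w v => v = w).
Proof.
  split; [|split]; simpl; auto.
  - intros; tauto.
  - intros F V HV w v H. symmetry. apply HV. intros f Hf.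
    apply (H (fun _ => Top)); [apply good_top|]. intros z ->. exact Hf.
Qed.

Lemma captures_ctx_step G c P l : env_wf G -> captures_ctx G c P ->
  captures_ctx G (CBox c l) (fun F w v => exists z, P F w z /\ R F l z v).
Proof.
  intros HG [H1 [H2 H3]]. split; [|split]; simpl; auto.
  - intros F w V HV v. split; intros [z [Hz Hz']]; exists z; split; auto;
      apply (H2 F w V HV); auto.
  - intros F V HV w v H.
    destruct (@directed_backward F V HV
      (fun f => exists s, good G w (sval V s) /\ forall x, pts (sval V s) w c x -> sat V x f) l v)
      as [y [Hy Hy']].
    + apply directed_good with (X := fun U => pts U w c); auto.
      intros V1 V2 H12. apply pts_mono with (length G); auto.
    (* A formula true at all successors of an upper bound for [c] is an upper bound for [CBox c l],
       hence true at [v]. *)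
    + intros f g [s [Hs Hf]] Hg. apply (H s g Hs). intros z [y [Hy Hyz]].
      apply (Hg y); auto.
    + exists y. split; auto. apply (H3 F V HV). intros s f Hs Hf. apply Hy'. eauto.
Qed.

Lemma captures_ctx_and G c A P Q : captures_ctx G c P -> captures_form G A Q ->
  captures_ctx G (CImp c A) (fun F w v => P F w v /\ Q F w v).
Proof.
  intros [H1 [H2 H3]] [K1 [K2 K3]]. split; [|split]; simpl; auto.
  - intros F w V HV v. rewrite (H2 F w V HV), (K2 F w V HV). tauto.
  - intros F V HV w v H. split.
    + apply (H3 F V HV). intros s f Hs Hf. apply (H s f Hs). intros z [Hz _]. auto.
    (* The upper bound used here is [subst s A] itself, because [CImp] keeps only points satisfying
       [A]. *)
    + apply (K3 F V HV). intros s Hs. apply sat_subst.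
      apply (H s _ Hs). intros z [_ Hz]. apply sat_subst. exact Hz.
Qed.

Lemma captures_form_and G A B P Q : captures_form G A P -> captures_form G B Q ->
  captures_form G (And A B) (fun F w v => P F w v /\ Q F w v).
Proof.
  intros [H1 [H2 H3]] [K1 [K2 K3]]. split; [|split].
  - destruct H1 as [H1 H1'], K1 as [K1 K1']. split.
    + intros q [Hq|Hq]; firstorder.
    + intros q [[Hq|Hq]|[Hq|Hq]]; firstorder.
  - intros F w V HV v. simpl. rewrite (H2 F w V HV), (K2 F w V HV). tauto.
  - intros F V HV w v H. split.
    + apply (H3 F V HV). intros s Hs. apply (H s Hs).
    + apply (K3 F V HV). intros s Hs. apply (H s Hs).
Qed.

Lemma captures_form_top G : captures_form G Top (fun F w v => True).
Proof.
  split; [|split]; simpl; auto; try tauto.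
  split; [intros q []|intros q [[]|[]]].
Qed.

Lemma captures_form_dia G A P l : env_wf G -> captures_form G A P ->
  captures_form G (Dia l A) (fun F w v => exists z, R F l v z /\ P F w z).
Proof.
  intros HG [H1 [H2 H3]]. split; [|split]; simpl; auto.
  - intros F w V HV v. split; intros [z [Hz Hz']]; exists z; split; auto;
      apply (H2 F w V HV); auto.
  - intros F V HV w v H.
    destruct (@directed_forward F V HV
      (fun f => exists s, good G w (sval V s) /\ forall x, sat (sval V s) x A -> sat V x f) l v)
      as [y [Hy Hy']].
    + apply directed_good with (X := fun U x => sat U x A); auto.
      intros V1 V2 H12. apply sat_mono_below with (length G); auto.
    + intros f [s [Hs Hf]]. destruct (H s Hs) as [y [Hy Hy']]. eauto.
    + exists y. split; auto. apply (H3 F V HV). intros s Hs. apply sat_subst.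
      apply Hy'. exists s. split; auto. intros x. apply sat_subst.
Qed.

Lemma nth_error_snoc {X} (G : list X) c i d :
  nth_error (G ++ [c]) i = Some d -> nth_error G i = Some d \/ i = length G /\ d = c.
Proof.
  intros H. destruct (Nat.lt_trichotomy i (length G)) as [L|[L|L]].
  - rewrite nth_error_app1 in H; auto.
  - subst. rewrite nth_error_app2, Nat.sub_diag in H by lia. injection H as <-. auto.
  - rewrite (proj2 (nth_error_None _ _)) in H; [discriminate|]. rewrite length_app. simpl. lia.
Qed.

Lemma env_wf_snoc G c : env_wf G -> ctx_below (length G) c -> env_wf (G ++ [c]).
Proof.
  intros HG Hc i d Hi. apply nth_error_snoc in Hi. destruct Hi as [Hi|[-> ->]]; auto.
Qed.

(** The fresh variable has minimal value [pts], and the formulas that may be substituted for it are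
    exactly the upper bounds [f] quantified over in [captures_ctx]. *)
Lemma captures_ctx_var G c P : env_wf G -> captures_ctx G c P ->
  captures_form (G ++ [c]) (Var (length G)) P.
Proof.
  intros HG [H1 [H2 H3]].
  assert (Hlast : nth_error (G ++ [c]) (length G) = Some c)
    by (rewrite nth_error_app2, Nat.sub_diag by lia; reflexivity).
  split; [|split].
  - split; [intros q [? _]; discriminate|].
    rewrite length_app. intros q [[_ <-]|[? _]]; [simpl; lia|discriminate].
  - intros F w V HV v. simpl. rewrite (HV _ _ Hlast).
    apply H2. apply exact_prefix with [c]; auto.
  - intros F V HV w v H. apply (H3 F V HV). intros s f Hs Hf.
    set (s' := fun q => if q =? length G then f else s q).
    assert (E : forall q, q < length G -> s' q = s q).
    { intros q Hq. unfold s'. destruct (Nat.eqb_spec q (length G)); auto. lia. }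
    assert (E' : s' (length G) = f) by (unfold s'; rewrite Nat.eqb_refl; auto).
    enough (Hg : good (G ++ [c]) w (sval V s')).
    { specialize (H s' Hg). simpl in H. unfold sval in H. rewrite E' in H. exact H. }
    intros i d Hi z Hz. apply nth_error_snoc in Hi. destruct Hi as [Hi|[-> ->]].
    + assert (Hl : i < length G) by (apply nth_error_Some; congruence).
      unfold sval. rewrite E by auto. apply (Hs _ _ Hi). revert Hz.
      apply pts_mono with i; auto. intros q Hq x. unfold sval. rewrite E; auto. lia.
    + unfold sval. rewrite E'. apply Hf. revert Hz.
      apply pts_mono with (length G); auto. intros q Hq x. unfold sval. rewrite E; auto.
Qed.

(** The initial environment is arbitrary so that the second part of a conjunction can extend the
    environment left by the first. *)
Definition captured (b : bool) (Q : forall F : frame Lam, W F -> W F -> Prop) : Prop :=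
  forall G, env_wf G -> exists H, env_wf (G ++ H) /\
    if b then exists c, captures_ctx (G ++ H) c Q else exists A, captures_form (G ++ H) A Q.

Lemma walk_def_captured b Q : walk_def b Q -> captured b Q.
Proof.
  induction 1 as [|l P _ IH|b P Q _ IHP _ IHQ| |l P _ IH|P _ IH|b P Q HPQ _ IH]; intros G HG.
  - exists []. rewrite app_nil_r. split; auto. exists Hole. apply captures_ctx_root.
  - destruct (IH G HG) as [H [HH [c Hc]]]. exists H. split; auto.
    exists (CBox c l). apply captures_ctx_step; auto.
  - destruct (IHP G HG) as [H [HH Hc]].
    destruct (IHQ _ HH) as [H' [HH' [A HA]]].
    exists (H ++ H'). rewrite app_assoc. split; auto.
    destruct b; destruct Hc as [c Hc].
    + exists (CImp c A). apply captures_ctx_and; auto. apply captures_ctx_extend; auto.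
    + exists (And c A). apply captures_form_and; auto. apply captures_form_extend; auto.
  - exists []. rewrite app_nil_r. split; auto. exists Top. apply captures_form_top.
  - destruct (IH G HG) as [H [HH [A HA]]]. exists H. split; auto.
    exists (Dia l A). apply captures_form_dia; auto.
  - destruct (IH G HG) as [H [HH [c Hc]]]. exists (H ++ [c]). rewrite app_assoc. split.
    + apply env_wf_snoc; auto. apply Hc.
    + exists (Var (length (G ++ H))). apply captures_ctx_var; auto.
  - destruct (IH G HG) as [H [HH HX]]. exists H. split; auto.
    destruct b; destruct HX as [c [H1 [H2 H3]]]; exists c; (split; [exact H1|split]).
    + intros F w V HV v. rewrite <- HPQ. apply H2, HV.
    + intros F V HV w v H0. apply HPQ. apply (H3 F V HV w v H0).
    + intros F w V HV v. rewrite <- HPQ. apply H2, HV.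
    + intros F V HV w v H0. apply HPQ. apply (H3 F V HV w v H0).
Qed.

(** * The generalised Sahlqvist formula of a predicate *)

Fixpoint antecedent (k : nat) (G : env) : form Lam :=
  match G with
  | [] => Top
  | c :: G => And (fill c (Var k)) (antecedent (S k) G)
  end.

Lemma sat_antecedent F (V : nat -> W F -> Prop) w G : forall k,
  sat V w (antecedent k G) <->
  forall i c, nth_error G i = Some c -> forall z, pts V w c z -> V (k + i) z.
Proof.
  induction G as [|c G IH]; simpl; intros k.
  - split; auto. intros _ i c H. destruct i; discriminate.
  - rewrite IH, sat_fill. simpl. split.
    + intros [H1 H2] [|i] d Hd z Hz; simpl in Hd.
      * injection Hd as <-. rewrite Nat.add_0_r. auto.
      * rewrite Nat.add_succ_r. apply (H2 i d Hd z Hz).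
    + intros H. split.
      * intros z Hz. specialize (H 0 c eq_refl z Hz). rewrite Nat.add_0_r in H. exact H.
      * intros i d Hd z Hz. specialize (H (S i) d Hd z Hz). rewrite Nat.add_succ_r in H. exact H.
Qed.

Lemma coreg_antecedent G : forall k,
  (forall i c, nth_error G i = Some c -> ctx_below (k + i) c) -> coreg lt (antecedent k G).
Proof.
  induction G as [|c G IH]; simpl; intros k H.
  - apply coreg_negf. intros q [].
  - apply coreg_and.
    + apply coreg_bf with k. apply fill_boxform; [|constructor].
      specialize (H 0 c eq_refl). rewrite Nat.add_0_r in H. exact H.
    + apply IH. intros i d Hd. specialize (H (S i) d Hd). rewrite Nat.add_succ_r in H. exact H.
Qed.

Lemma clos_trans_lt_irrefl p : ~ clos_trans nat lt p p.
Proof.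
  assert (H : forall a b, clos_trans nat lt a b -> a < b) by (induction 1; lia).
  intros Hp. apply H in Hp. lia.
Qed.

(** The antecedent says that the valuation is good, and the exact valuation is the least good one,
    so for a positive consequent it is the only one that has to be tested. The order [lt] serves as
    dependency digraph because each box-form reads only variables below its head. *)
Theorem walk_def_gen_sahlqvist b Q : walk_def b Q -> exists f, gen_sahlqvist f /\
  (forall F w, valid_at F w f <-> Q F w w) /\
  (forall F (V : nat -> W F -> Prop), saturated V -> forall w,
     (forall s, sat V w (subst s f)) -> Q F w w).
Proof.
  intros HQ. assert (HQ' : walk_def false Q) by (destruct b; auto using wd_weaken).
  destruct (walk_def_captured HQ' (G := [])) as [G [HG [A [H1 [H2 H3]]]]].
  { intros i c H. destruct i; discriminate. }
  simpl in *. exists (Imp (antecedent 0 G) A).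
  assert (Hgood : forall F w (V : nat -> W F -> Prop), sat V w (antecedent 0 G) <-> good G w V)
    by (intros; apply sat_antecedent).
  split; [|split].
  - exists lt. split; [apply clos_trans_lt_irrefl|]. apply reg_imp.
    + apply coreg_antecedent. exact HG.
    + apply reg_pos, H1.
  - intros F w. split.
    + intros Hv. destruct (exact_exists F w HG) as [V HV]. apply (H2 F w V HV).
      apply (Hv V). apply Hgood, exact_good, HV.
    + intros Hw V HV. apply Hgood in HV. destruct (exact_exists F w HG) as [V0 HV0].
      apply (H2 F w V0 HV0) in Hw. revert Hw. apply sat_mono_below with (length G); auto.
      apply exact_least with w; auto.
  - intros F V HV w Hw. apply (H3 F V HV). intros s Hs.
    specialize (Hw s). apply sat_subst in Hw. apply Hw, Hgood, Hs.
Qed.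
End Modal.

(** * Canonical models *)

Unset Implicit Arguments.

Section Canonical.
Variable Lam : Type.
Variable G : form Lam -> Prop.
Notation L := (Deriv G).

Lemma sat_beval F (V : nat -> W F -> Prop) (x : W F) (v : form Lam -> bool) f :
  (forall g, v g = true <-> sat V x g) -> (beval v f = true <-> sat V x f).
Proof.
  intros Hv. induction f; simpl; try apply Hv; try tauto.
  - split; [discriminate | tauto].
  - rewrite Bool.negb_true_iff, <- IHf. destruct (beval v f); intuition congruence.
  - rewrite Bool.andb_true_iff, IHf1, IHf2. tauto.
  - rewrite Bool.orb_true_iff, IHf1, IHf2. tauto.
  - rewrite <- IHf1, <- IHf2. destruct (beval v f1), (beval v f2); simpl; intuition congruence.
Qed.

Lemma tautology_sat F (V : nat -> W F -> Prop) (x : W F) (f : form Lam) :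
  tautology f -> sat V x f.
Proof.
  intros Hf.
  apply (sat_beval F V x (fun g => if excluded_middle_informative (sat V x g) then true else false)); auto.
  intros g. destruct excluded_middle_informative; intuition congruence.
Qed.

Theorem soundness F : (forall g, G g -> frame_valid F g) -> forall f, L f -> frame_valid F f.
Proof.
  intros HG f. induction 1 as [f Hf|f Hf|l f g|l f|l f|f g _ IH1 _ IH2|l f _ IH|s f _ IH];
    intros w V; simpl; auto.
  - apply HG; auto.
  - apply tautology_sat; auto.
  - intros [v [Hv H]] Hn. apply (Hn v Hv H).
  - intros H. apply NNPP. intros Hn. apply H. intros v Hv H1. apply Hn. eauto.
  - apply (IH1 w V), IH2.
  - intros v _. apply IH.
  - apply sat_subst, IH.
Qed.

(** * Derivability from assumptions *)

Lemma taut_mp1 f g : L f -> tautology (Imp f g) -> L g.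
Proof. intros Hf Ht. apply d_mp with f; auto. apply d_taut, Ht. Qed.

Lemma taut_mp2 f g h : L f -> L g -> tautology (Imp f (Imp g h)) -> L h.
Proof. intros Hf Hg Ht. apply d_mp with g; auto. apply d_mp with f; auto. apply d_taut, Ht. Qed.

Ltac taut := let v := fresh "v" in intros v; simpl;
  repeat match goal with
  | |- context [beval v ?f] => destruct (beval v f); simpl
  | |- context [v ?f] => destruct (v f); simpl
  end; reflexivity.

Lemma conj_incl l1 l2 : incl l2 l1 -> tautology (Imp (conj l1) (conj l2 : form Lam)).
Proof.
  intros H v. simpl.
  assert (E : forall l, beval v (conj l) = true <-> forall f, In f l -> beval v f = true).
  { induction l as [|f l IH]; simpl; [intuition|].
    rewrite Bool.andb_true_iff, IH. intuition (subst; auto). }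
  destruct (beval v (conj l1)) eqn:E1; auto. simpl.
  apply E. intros f Hf. apply (proj1 (E l1) E1). auto.
Qed.

Definition entails (S : form Lam -> Prop) (f : form Lam) : Prop :=
  exists l, Forall S l /\ L (Imp (conj l) f).

Lemma entails_in (S : form Lam -> Prop) f : S f -> entails S f.
Proof.
  intros H. exists [f]. split; [auto|]. apply d_taut. taut.
Qed.

Lemma entails_thm S f : L f -> entails S f.
Proof. intros H. exists []. split; [auto|]. apply (taut_mp1 _ _ H). taut. Qed.

Lemma entails_mp S f g : entails S (Imp f g) -> entails S f -> entails S g.
Proof.
  intros [l1 [H1 K1]] [l2 [H2 K2]]. exists (l1 ++ l2). split; [apply Forall_app; auto|].
  assert (T1 := d_taut G (conj_incl (l1 ++ l2) l1 ltac:(apply incl_appl, incl_refl))).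
  assert (T2 := d_taut G (conj_incl (l1 ++ l2) l2 ltac:(apply incl_appr, incl_refl))).
  assert (L (Imp (conj (l1 ++ l2)) (Imp f g))) by (apply (taut_mp2 _ _ _ T1 K1); taut).
  assert (L (Imp (conj (l1 ++ l2)) f)) by (apply (taut_mp2 _ _ _ T2 K2); taut).
  apply (taut_mp2 _ _ _ H H0). taut.
Qed.

Lemma entails_taut1 S f g : entails S f -> tautology (Imp f g) -> entails S g.
Proof. intros H T. apply entails_mp with f; auto. apply entails_thm, d_taut, T. Qed.

Lemma entails_taut2 S f g h : entails S f -> entails S g -> tautology (Imp f (Imp g h)) -> entails S h.
Proof.
  intros H1 H2 T. apply entails_mp with g; auto. apply entails_mp with f; auto.
  apply entails_thm, d_taut, T.
Qed.

Lemma entails_deduction S f g : entails (fun h => S h \/ h = f) g -> entails S (Imp f g).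
Proof.
  intros [l [Hl Hg]]. revert g Hg. induction Hl as [|h l [Hh|Hh] _ IH]; intros g Hg.
  - apply entails_thm. apply (taut_mp1 _ _ Hg). simpl. taut.
  - assert (H1 : L (Imp (conj l) (Imp h g))) by (apply (taut_mp1 _ _ Hg); simpl; taut).
    apply IH in H1. apply (entails_taut2 _ _ _ _ H1 (entails_in _ _ Hh)). taut.
  - subst h. assert (H1 : L (Imp (conj l) (Imp f g))) by (apply (taut_mp1 _ _ Hg); simpl; taut).
    apply IH in H1. apply (entails_taut1 _ _ _ H1). taut.
Qed.

Lemma entails_mono (S T : form Lam -> Prop) f : (forall g, S g -> T g) -> entails S f -> entails T f.
Proof. intros H [l [H1 H2]]. exists l. split; auto. apply (Forall_impl _ H H1). Qed.

(** * Maximal consistent sets *)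

Lemma mcs_closed S f : mcs L S -> entails S f -> S f.
Proof.
  intros [Hc Hm] Hf. destruct (Hm f) as [H|H]; auto.
  destruct Hc. apply (entails_taut2 _ _ _ Bot Hf (entails_in _ _ H)). taut.
Qed.

(** The alternative [Forall B l] accounts for the empty chain, which has no member to offer. *)
Lemma chain_list (C : (form Lam -> Prop) -> Prop) (B : form Lam -> Prop) l :
  classical_sets.total_on C (@classical_sets.subset (form Lam)) ->
  Forall (fun f => B f \/ exists X, C X /\ X f) l ->
  Forall B l \/ exists X, C X /\ Forall (fun f => B f \/ X f) l.
Proof.
  intros Ht. induction 1 as [|f l Hf _ IH]; auto.
  destruct Hf as [Hf|[X [HX Hf]]], IH as [IH|[Y [HY IH]]].
  - auto.
  - right. exists Y. auto.
  - right. exists X. split; auto. constructor; auto. apply (Forall_impl _ (fun g Hg => or_introl Hg) IH).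
  - right. destruct (Ht X Y HX HY) as [H|H].
    + exists Y. split; auto.
    + exists X. split; auto. constructor; auto. revert IH. apply Forall_impl. intros g [Hg|Hg]; auto.
Qed.

(** Zorn is applied to the sets consistent together with [B], not to the sets including [B], so that
    the empty union is admissible as well. *)
Lemma lindenbaum B : consistent L B -> exists S, mcs L S /\ forall f, B f -> S f.
Proof.
  intros HB.
  destruct (@classical_sets.Zorn_bigcup (form Lam)
    (fun X => consistent L (fun f => B f \/ X f))) as [X [HX Hmax]].
  - intros C HC Ht [l [Hl Hd]].
    assert (Hl' : Forall (fun f => B f \/ exists X, C X /\ X f) l).
    { revert Hl. apply Forall_impl. intros f [Hf|[Y HY HYf]]; eauto. }
    destruct (chain_list C B l Ht Hl') as [H|[X [HX H]]].
    + apply HB. exists l. auto.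
    + apply (HC X HX). exists l. auto.
  - exists (fun f => B f \/ X f). split; auto. split; auto.
    intros f. apply NNPP. intros Hn.
    assert (Hbot : forall g, ~ (B g \/ X g) -> entails (fun h => B h \/ X h) (Imp g Bot)).
    { intros g Hg. apply NNPP. intros Hi.
      apply (Hmax (fun h => X h \/ h = g)).
      - split; [intros h Hh; left; exact Hh|]. intros Hs. apply Hg. right. apply Hs. right. reflexivity.
      - intros Hi'. apply Hi. apply entails_deduction.
        apply entails_mono with (2 := Hi'). tauto. }
    apply HX.
    apply (entails_taut2 _ _ _ Bot (Hbot f ltac:(tauto)) (Hbot (Neg f) ltac:(tauto))). taut.
Qed.

(** * The canonical model *)

Notation CF := (canonical_frame L).
Definition canonical_val : nat -> W CF -> Prop := fun p S => proj1_sig S (Var p).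

Lemma unboxed_entails S l f : mcs L S -> entails (fun g => S (Box l g)) f -> S (Box l f).
Proof.
  intros HS [k [Hk Hf]]. revert f Hf. induction Hk as [|g k Hg _ IH]; intros f Hf.
  - apply mcs_closed; auto. apply entails_thm, d_nec, (taut_mp1 _ _ Hf). simpl. taut.
  - assert (H1 : L (Imp (conj k) (Imp g f))) by (apply (taut_mp1 _ _ Hf); simpl; taut).
    apply IH in H1. apply mcs_closed; auto.
    apply entails_mp with (Box l g); [|apply entails_in; auto].
    apply entails_mp with (Box l (Imp g f)); [|apply entails_in; auto].
    apply entails_thm, d_K.
Qed.

Lemma canonical_box (S : W CF) l f :
  proj1_sig S (Box l f) <-> forall T, R CF l S T -> proj1_sig T f.
Proof.
  split; [intros H T HT; apply HT, H|]. intros H. apply NNPP. intros Hn.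
  destruct (lindenbaum (fun g => proj1_sig S (Box l g) \/ g = Neg f)) as [T [HT HTB]].
  - intros Hi. apply Hn. apply unboxed_entails; [apply (proj2_sig S)|].
    apply (entails_deduction _ _ Bot) in Hi. apply (entails_taut1 _ _ _ Hi). taut.
  - assert (Hf : T f).
    { apply (H (exist _ T HT)). intros g Hg. apply HTB. left. exact Hg. }
    assert (Hnf : T (Neg f)) by auto. destruct HT as [Hc _]. apply Hc.
    apply (entails_taut2 _ _ _ Bot (entails_in _ _ Hf) (entails_in _ _ Hnf)). taut.
Qed.

Lemma mcs_neg S f : mcs L S -> (S (Neg f) <-> ~ S f).
Proof.
  intros HS. split.
  - intros H1 H2. apply (proj1 HS).
    apply (entails_taut2 _ _ _ Bot (entails_in _ _ H1) (entails_in _ _ H2)). taut.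
  - intros H. destruct (proj2 HS f); tauto.
Qed.

Lemma truth_lemma f : forall S : W CF, sat canonical_val S f <-> proj1_sig S f.
Proof.
  induction f; simpl; intros S; assert (HS := proj2_sig S); simpl in HS.
  - reflexivity.
  - split; auto. intros _. apply mcs_closed; auto. apply entails_thm, d_taut. taut.
  - split; [tauto|]. intros H. apply (proj1 HS). apply entails_in. exact H.
  - rewrite IHf, mcs_neg; tauto.
  - rewrite IHf1, IHf2. split.
    + intros [H1 H2]. apply mcs_closed; auto.
      apply (entails_taut2 _ _ _ _ (entails_in _ _ H1) (entails_in _ _ H2)). taut.
    + intros H. split; apply mcs_closed; auto; apply (entails_taut1 _ _ _ (entails_in _ _ H)); taut.
  - rewrite IHf1, IHf2. split.
    + intros [H|H]; apply mcs_closed; auto; apply (entails_taut1 _ _ _ (entails_in _ _ H)); taut.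
    + intros H. apply NNPP. intros Hn.
      assert (H1 : proj1_sig S (Neg f1)) by (apply mcs_neg; tauto).
      apply Hn. right. apply mcs_closed; auto.
      apply (entails_taut2 _ _ _ _ (entails_in _ _ H) (entails_in _ _ H1)). taut.
  - rewrite IHf1, IHf2. split.
    + intros H. destruct (classic (proj1_sig S f1)) as [H1|H1].
      * apply H in H1. apply mcs_closed; auto. apply (entails_taut1 _ _ _ (entails_in _ _ H1)). taut.
      * apply mcs_neg in H1; auto. apply mcs_closed; auto.
        apply (entails_taut1 _ _ _ (entails_in _ _ H1)). taut.
    + intros H H1. apply mcs_closed; auto.
      apply (entails_mp _ _ _ (entails_in _ _ H) (entails_in _ _ H1)).
  - rewrite canonical_box. split; intros H T HT; apply IHf, H; auto.
  - assert (E : proj1_sig S (Dia l f) <-> ~ proj1_sig S (Box l (Neg f))).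
    { rewrite <- mcs_neg by auto. split; intros H; apply mcs_closed; auto;
        apply entails_mp with (2 := entails_in _ _ H); apply entails_thm; first [apply d_dual1 | apply d_dual2]. }
    rewrite E, canonical_box. split.
    + intros [T [HT H]] Hn. apply IHf in H. apply Hn in HT.
      apply mcs_neg in HT; auto. apply (proj2_sig T).
    + intros H. apply NNPP. intros Hn. apply H. intros T HT. apply mcs_neg; [apply (proj2_sig T)|].
      intros Hf. apply Hn. exists T. split; auto. apply IHf, Hf.
Qed.

Lemma mcs_ext (S T : W CF) : (forall f, proj1_sig S f -> proj1_sig T f) -> S = T.
Proof.
  intros H. destruct S as [S HS], T as [T HT]. simpl in H.
  assert (E : S = T).
  { apply functional_extensionality. intros f. apply propositional_extensionality.
    split; auto. intros Hf. apply NNPP. intros Hn. apply (mcs_neg _ _ HS), H in Hn.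
    apply (mcs_neg _ _ HT) in Hn. auto. }
  subst T. f_equal. apply proof_irrelevance.
Qed.

(** Compactness is Lindenbaum's lemma, tightness is the definition of the canonical relations, and
    differentiation is maximality. *)
Lemma canonical_saturated : saturated canonical_val.
Proof.
  split; [|split].
  - intros B HB. destruct (lindenbaum B) as [S [HS HBS]].
    + intros [l [Hl Hd]]. destruct (HB l Hl) as [x Hx].
      apply (proj1 (proj2_sig x)). exists l. split; auto.
      revert Hx. apply Forall_impl. intros f. apply truth_lemma.
    + exists (exist _ S HS). intros f Hf. apply truth_lemma. simpl. auto.
  - intros l x y H f Hf. apply truth_lemma, H, truth_lemma, Hf.
  - intros x y H. apply mcs_ext. intros f Hf. apply truth_lemma, H, truth_lemma, Hf.
Qed.

Lemma canonical_theorem f (S : W CF) : L f -> sat canonical_val S f.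
Proof. intros H. apply truth_lemma, mcs_closed; [apply (proj2_sig S)|]. apply entails_thm, H. Qed.

Lemma canonical_complete f : (forall S : W CF, sat canonical_val S f) -> L f.
Proof.
  intros H. apply NNPP. intros Hn.
  destruct (lindenbaum (fun g => g = Neg f)) as [S [HS HB]].
  - intros Hi. apply Hn.
    assert (Hi' : entails (fun _ => False) (Imp (Neg f) Bot)).
    { apply entails_deduction. apply entails_mono with (2 := Hi). auto. }
    destruct Hi' as [[|h l] [Hl Hd]].
    + apply (taut_mp1 _ _ Hd). simpl. taut.
    + inversion Hl. contradiction.
  - specialize (H (exist _ S HS)). apply truth_lemma in H. simpl in H.
    apply (mcs_neg _ _ HS) in H; auto.
Qed.
End Canonical.

(** * Diagrams that are forests off the root *)

Set Implicit Arguments.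

Section Diagrams.
Variable Lam : Type.
Notation edge := (Lam * nat * nat)%type.
Implicit Types (E : list edge) (e : edge).

(** * Connectivity off the root *)

Inductive conn E : nat -> nat -> Prop :=
| conn_refl u : conn E u u
| conn_fwd l u v z : u <> 0 -> v <> 0 -> In (l, u, v) E -> conn E v z -> conn E u z
| conn_bwd l u v z : u <> 0 -> v <> 0 -> In (l, v, u) E -> conn E v z -> conn E u z.

Lemma conn_trans E u v z : conn E u v -> conn E v z -> conn E u z.
Proof. induction 1; intros; eauto using conn. Qed.

Lemma conn_sym E u v : conn E u v -> conn E v u.
Proof.
  induction 1; [constructor| |];
    (eapply conn_trans; [eassumption|]); eauto using conn.
Qed.

Lemma conn_incl E E' u v : incl E E' -> conn E u v -> conn E' u v.
Proof. intros H. induction 1; eauto using conn. Qed.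

Lemma conn_nonzero E u v : u <> 0 -> conn E u v -> v <> 0.
Proof. intros Hu. induction 1; auto. Qed.

(** An edge at the root counts as part of the component of its other end. *)
Definition touches E u e : Prop :=
  match e with (_, a, b) => (a <> 0 /\ conn E u a) \/ (b <> 0 /\ conn E u b) end.

Lemma touches_endpoints E u l a b : In (l, a, b) E -> touches E u (l, a, b) ->
  (a <> 0 -> conn E u a) /\ (b <> 0 -> conn E u b).
Proof.
  intros He [[H0 H]|[H0 H]]; split; intros H1; auto.
  - apply conn_trans with a; auto. eauto using conn.
  - apply conn_trans with b; auto. eauto using conn.
Qed.

(** All copies of the edge are deleted: edges are compared as triples, as they are in
    [undirected_cycle]. *)
Definition remove_edge e E : list edge :=
  filter (fun d => if excluded_middle_informative (d = e) then false else true) E.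

Lemma in_remove_edge e E d : In d (remove_edge e E) <-> In d E /\ d <> e.
Proof.
  unfold remove_edge. rewrite filter_In.
  destruct excluded_middle_informative; intuition congruence.
Qed.

Lemma remove_edge_incl e E : incl (remove_edge e E) E.
Proof. intros d Hd. apply in_remove_edge in Hd. tauto. Qed.

Lemma remove_edge_length e E : In e E -> length (remove_edge e E) < length E.
Proof.
  unfold remove_edge. induction E as [|d E IH]; simpl; [tauto|]. intros H.
  assert (Hle := filter_length_le
    (fun d => if excluded_middle_informative (d = e) then false else true) E).
  destruct excluded_middle_informative; simpl; [lia|].
  destruct H as [->|H]; [tauto|]. apply IH in H. lia.
Qed.

(** Every edge between non-root points is a bridge; this is the form in which the forest property
    enters the induction. *)
Definition acyclic E : Prop :=
  forall l u v, u <> 0 -> v <> 0 -> In (l, u, v) E -> ~ conn (remove_edge (l, u, v) E) u v.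

Lemma acyclic_remove_edge e E : acyclic E -> acyclic (remove_edge e E).
Proof.
  intros H l u v Hu Hv Hin Hc. apply (H l u v Hu Hv).
  - apply (remove_edge_incl _ _ _ Hin).
  - revert Hc. apply conn_incl. intros d Hd. apply in_remove_edge in Hd.
    destruct Hd as [Hd Hn]. apply in_remove_edge. split; auto.
    apply (remove_edge_incl _ _ _ Hd).
Qed.

Inductive reachable E (S : nat -> Prop) : nat -> Prop :=
| reachable_src a : S a -> reachable E S a
| reachable_step l a b : reachable E S a -> In (l, a, b) E -> reachable E S b.

Lemma reachable_mono E (S T : nat -> Prop) a : (forall x, S x -> T x) ->
  reachable E S a -> reachable E T a.
Proof. intros H. induction 1; eauto using reachable. Qed.

Lemma reachable_incoming E u : reachable E (eq 0) u -> u <> 0 -> exists l c, In (l, c, u) E.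
Proof. destruct 1 as [a Ha|l a b _ Hin]; intros H0; [congruence|eauto]. Qed.

Definition zero_or (v a : nat) : Prop := a = 0 \/ a = v.

(* Removing an edge splits the component of [v] off the root; whatever was reached
   through the removed edge [(l, c, d)] is now reached from [d]. *)
Lemma reachable_split E l c d (S : nat -> Prop) v a :
  (forall x, x <> 0 -> S x -> conn (remove_edge (l, c, d) E) v x -> x = v) ->
  reachable E S a -> a <> 0 -> conn (remove_edge (l, c, d) E) v a ->
  reachable (remove_edge (l, c, d) E)
    (fun x => x = 0 \/ (x = v /\ S v) \/ (x = d /\ conn (remove_edge (l, c, d) E) v d)) a.
Proof.
  intros HS H. induction H as [a Ha|l' b a Hb IH Hin]; intros H0 Hc.
  - apply reachable_src. right. left. assert (a = v) by auto. subst. auto.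
  - destruct (classic ((l', b, a) = (l, c, d))) as [E1|E1].
    + injection E1 as -> -> ->. apply reachable_src. auto.
    + assert (Hin' : In (l', b, a) (remove_edge (l, c, d) E)) by (apply in_remove_edge; auto).
      apply reachable_step with (2 := Hin').
      destruct (Nat.eq_dec b 0) as [->|Hb0]; [apply reachable_src; auto|].
      apply IH; auto. apply conn_trans with a; auto. eauto using conn.
Qed.

(* The existential condition on [x], in the place of [v], and on [w], in the place of the
   root, imposed by the part of the diagram that is connected to [v] off the root. *)
Definition comp_pred E v (F : frame Lam) (w x : W F) : Prop :=
  exists h : nat -> W F, h 0 = w /\ h v = x /\
    forall l a b, In (l, a, b) E -> touches E v (l, a, b) -> R F l (h a) (h b).

Lemma comp_pred_nil E v (F : frame Lam) (w x : W F) : v <> 0 ->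
  (forall l a b, In (l, a, b) E -> a <> v /\ b <> v) -> comp_pred E v F w x.
Proof.
  intros Hv Hno. exists (fun k => if k =? 0 then w else x).
  split; [reflexivity|]. split; [destruct (Nat.eqb_spec v 0); tauto|].
  assert (Hc : forall a, conn E v a -> a = v).
  { intros a Ha. destruct Ha as [|l u v' z _ _ Hin _|l u v' z _ _ Hin _]; auto;
      apply Hno in Hin; tauto. }
  intros l a b Hin Ht. destruct (Hno _ _ _ Hin).
  destruct Ht as [[_ Ht]|[_ Ht]]; apply Hc in Ht; tauto.
Qed.

Lemma touches_incl E E' u e : incl E E' -> touches E u e -> touches E' u e.
Proof.
  intros H. destruct e as [[l a] b]. intros [[H0 H1]|[H0 H1]]; [left|right]; split; auto;
    eapply conn_incl; eauto.
Qed.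

Lemma conn_remove_root l c d E u v : c = 0 \/ d = 0 -> conn E u v ->
  conn (remove_edge (l, c, d) E) u v.
Proof.
  intros H. induction 1 as [|l' u v z Hu Hv Hin _ IH|l' u v z Hu Hv Hin _ IH];
    [constructor|apply conn_fwd with l' v|apply conn_bwd with l' v]; auto;
    apply in_remove_edge; split; auto; intros E1; injection E1 as -> -> ->; tauto.
Qed.

Lemma conn_remove_edge l c d E v z : conn E v z ->
  conn (remove_edge (l, c, d) E) v z \/ conn (remove_edge (l, c, d) E) c z \/
  conn (remove_edge (l, c, d) E) d z.
Proof.
  induction 1 as [|l' u v z Hu Hv Hin _ IH|l' u v z Hu Hv Hin _ IH]; [left; constructor| |].
  - destruct (classic ((l', u, v) = (l, c, d))) as [E1|E1].
    + injection E1 as -> -> ->. tauto.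
    + destruct IH as [IH|IH]; [left|tauto].
      apply conn_fwd with l' v; auto. apply in_remove_edge. auto.
  - destruct (classic ((l', v, u) = (l, c, d))) as [E1|E1].
    + injection E1 as -> -> ->. tauto.
    + destruct IH as [IH|IH]; [left|tauto].
      apply conn_bwd with l' v; auto. apply in_remove_edge. auto.
Qed.

Lemma comp_pred_root_edge E v l c d (F : frame Lam) (w x : W F) : v <> 0 ->
  In (l, c, d) E -> (c = v /\ d = 0) \/ (c = 0 /\ d = v) ->
  comp_pred E v F w x <->
  comp_pred (remove_edge (l, c, d) E) v F w x /\
    R F l (if c =? 0 then w else x) (if d =? 0 then w else x).
Proof.
  intros Hv Hin Hcd. split.
  - intros [h [H0 [H1 H]]]. split.
    + exists h. split; auto. split; auto. intros l' a b Hin' Ht.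
      apply H; [apply (remove_edge_incl _ _ _ Hin')|].
      revert Ht. apply touches_incl, remove_edge_incl.
    + assert (HR : R F l (h c) (h d)).
      { apply H; auto. destruct Hcd as [[-> ->]|[-> ->]]; [left|right]; split; auto; constructor. }
      destruct Hcd as [[-> ->]|[-> ->]]; simpl; rewrite <- H0, <- H1;
        (destruct (Nat.eqb_spec v 0); [tauto|exact HR]).
  - intros [[h [H0 [H1 H]]] HR]. exists h. split; auto. split; auto.
    intros l' a b Hin' Ht. destruct (classic ((l', a, b) = (l, c, d))) as [E1|E1].
    + injection E1 as -> -> ->. destruct Hcd as [[-> ->]|[-> ->]]; simpl in HR;
        rewrite H0, H1; (destruct (Nat.eqb_spec v 0); [tauto|exact HR]).
    + apply H; [apply in_remove_edge; auto|].
      destruct Ht as [[? Ht]|[? Ht]]; [left|right]; split; auto; apply conn_remove_root; tauto.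
Qed.

Definition override {X} (E : list edge) (u : nat) (h h' : nat -> X) (k : nat) : X :=
  if excluded_middle_informative (conn E u k) then h' k else h k.

Lemma override_in {X} E u (h h' : nat -> X) k : conn E u k -> override E u h h' k = h' k.
Proof. intros H. unfold override. destruct excluded_middle_informative; tauto. Qed.

Lemma override_out {X} E u (h h' : nat -> X) k : ~ conn E u k -> override E u h h' k = h k.
Proof. intros H. unfold override. destruct excluded_middle_informative; tauto. Qed.

(** An edge of the component may end at the root, where [override] takes its value from [h];
    agreement at [0] settles that case. *)
Lemma override_edge_in {X} E u (h h' : nat -> X) l a b :
  u <> 0 -> h 0 = h' 0 -> In (l, a, b) E -> touches E u (l, a, b) ->
  override E u h h' a = h' a /\ override E u h h' b = h' b.
Proof.
  intros Hu H0 Hin Ht. apply touches_endpoints in Ht; auto.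
  assert (Hk : forall k, (k <> 0 -> conn E u k) -> override E u h h' k = h' k).
  { intros k Hk. destruct (Nat.eq_dec k 0) as [->|Hk0]; [|apply override_in; auto].
    unfold override. destruct excluded_middle_informative; auto. }
  split; apply Hk; tauto.
Qed.

Lemma override_edge_out {X} E u (h h' : nat -> X) l a b :
  u <> 0 -> In (l, a, b) E -> ~ touches E u (l, a, b) ->
  override E u h h' a = h a /\ override E u h h' b = h b.
Proof.
  intros Hu Hin Ht.
  split; apply override_out; intros Hc; apply Ht; [left|right]; split; auto;
    apply conn_nonzero with (2 := Hc); auto.
Qed.

(** Without the bridge, the component of [v] falls apart into those of [v] and [u], and assignments
    of the two parts glue because they agree at the root. *)
Lemma comp_pred_split E v u l c d (F : frame Lam) (w x : W F) : u <> 0 -> v <> 0 -> acyclic E ->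
  In (l, c, d) E -> (c = v /\ d = u) \/ (c = u /\ d = v) ->
  comp_pred E v F w x <->
  comp_pred (remove_edge (l, c, d) E) v F w x /\
  exists y, R F l (if c =? v then x else y) (if c =? v then y else x) /\
    comp_pred (remove_edge (l, c, d) E) u F w y.
Proof.
  intros Hu Hv Hac Hin Hcd.
  set (E' := remove_edge (l, c, d) E).
  assert (Hi : incl E' E) by apply remove_edge_incl.
  assert (Hsep : ~ conn E' u v).
  { intros H. destruct Hcd as [[-> ->]|[-> ->]].
    - apply (Hac l v u Hv Hu Hin). apply conn_sym, H.
    - apply (Hac l u v Hu Hv Hin H). }
  assert (Huv : u <> v) by (intros ->; apply Hsep; constructor).
  assert (Hvu : conn E v u).
  { destruct Hcd as [[-> ->]|[-> ->]]; [apply conn_fwd with l u|apply conn_bwd with l u];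
      auto; constructor. }
  assert (Hsplit : forall z, conn E v z -> conn E' v z \/ conn E' u z).
  { intros z Hz. apply (conn_remove_edge l c d) in Hz.
    destruct Hcd as [[-> ->]|[-> ->]]; fold E' in Hz; tauto. }
  split.
  - intros [h [H0 [H1 H]]]. split.
    + exists h. split; auto. split; auto. intros l' a b Hin' Ht.
      apply H; auto. revert Ht. apply touches_incl; auto.
    + exists (h u). split.
      * assert (HR : R F l (h c) (h d)).
        { apply H; auto. destruct Hcd as [[-> ->]|[-> ->]]; left; split; auto. constructor. }
        rewrite <- H1. destruct Hcd as [[-> ->]|[-> ->]]; [rewrite Nat.eqb_refl; auto|].
        destruct (Nat.eqb_spec u v); tauto.
      * exists h. split; auto. split; auto. intros l' a b Hin' Ht. apply H; auto.
        apply (touches_incl _ _ Hi) in Ht.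
        destruct Ht as [[? Ht]|[? Ht]]; [left|right]; split; auto;
          apply conn_trans with u; auto.
  - intros [[h [H0 [H1 H]]] [y [HR [h' [H0' [H1' H']]]]]].
    exists (override E' u h h').
    assert (Hov : override E' u h h' v = x) by (rewrite override_out; auto).
    assert (Hou : override E' u h h' u = y) by (rewrite override_in; auto; constructor).
    split; [|split]; auto.
    + rewrite override_out; auto. intros Hc. apply (conn_nonzero Hu) in Hc. tauto.
    + intros l' a b Hin' Ht. destruct (classic ((l', a, b) = (l, c, d))) as [E1|E1].
      * injection E1 as -> -> ->.
        destruct Hcd as [[-> ->]|[-> ->]]; rewrite Hov, Hou.
        -- rewrite Nat.eqb_refl in HR. exact HR.
        -- destruct (Nat.eqb_spec u v); tauto.
      * assert (Hin2 : In (l', a, b) E') by (apply in_remove_edge; auto).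
        destruct (classic (touches E' u (l', a, b))) as [Hut|Hut].
        -- destruct (override_edge_in h h' Hu (eq_trans H0 (eq_sym H0')) Hin2 Hut) as [-> ->]. auto.
        -- destruct (override_edge_out h h' Hu Hin2 Hut) as [-> ->]. apply H; auto.
           destruct Ht as [[Ha Ht]|[Ha Ht]]; apply Hsplit in Ht; simpl in Hut |- *; tauto.
Qed.

(** One edge at [v] is cut off at a time. If some edge enters [v], what lies behind it is reachable
    from the root, so [v] is obtained from it by a forward step. Outgoing edges are diamonds, which
    give only the [false] form; they are cut only when nothing enters [v]. *)
Lemma comp_pred_walk_def n : forall E v, length E <= n -> acyclic E -> v <> 0 ->
  (forall a, conn E v a -> reachable E (zero_or v) a) ->
  walk_def false (comp_pred E v) /\
  ((exists l c, In (l, c, v) E) -> walk_def true (comp_pred E v)).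
Proof.
  induction n as [|n IH]; intros E v Hn Hac Hv Hr.
  { destruct E; [|simpl in Hn; lia]. split; [|intros [l [c []]]].
    apply wd_ext with (2 := wd_top Lam). intros F w x. split; auto.
    intros _. apply comp_pred_nil; auto. }
  (* If the deleted edge points to the root, to [v] or outside the remaining component of [v], no
     source besides the root and [v] arises. *)
  assert (Hv' : forall l c d, In (l, c, d) E ->
    (d = 0 \/ d = v \/ ~ conn (remove_edge (l, c, d) E) v d) ->
    walk_def false (comp_pred (remove_edge (l, c, d) E) v)).
  { intros l c d Hin Hd. apply IH; auto.
    - assert (Hl := remove_edge_length _ _ Hin). lia.
    - apply acyclic_remove_edge; auto.
    - intros a Ha. apply reachable_mono with
        (S := fun x => x = 0 \/ (x = v /\ zero_or v v) \/
                       (x = d /\ conn (remove_edge (l, c, d) E) v d)).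
      + intros x Hx. unfold zero_or. intuition congruence.
      + apply reachable_split with (S := zero_or v); auto.
        * intros x Hx [H|H] _; [congruence|auto].
        * apply Hr. revert Ha. apply conn_incl, remove_edge_incl.
        * apply conn_nonzero with (2 := Ha); auto. }
  assert (Hsep : forall l u, u <> 0 ->
    (In (l, u, v) E -> ~ conn (remove_edge (l, u, v) E) u v) /\
    (In (l, v, u) E -> ~ conn (remove_edge (l, v, u) E) u v)).
  { intros l u Hu. split; intros Hin Hc.
    - apply (Hac l u v); auto.
    - apply (Hac l v u); auto. apply conn_sym, Hc. }
  assert (Hin_edge : (exists l c, In (l, c, v) E) -> walk_def true (comp_pred E v)).
  { intros [l [u Hin]].
    assert (HE' : walk_def false (comp_pred (remove_edge (l, u, v) E) v)) by (apply Hv'; auto).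
    destruct (Nat.eq_dec u 0) as [->|Hu].
    - apply wd_ext with (2 := wd_and (wd_step l (wd_root Lam)) HE').
      intros F w x. rewrite (@comp_pred_root_edge E v l 0 v) by auto. simpl.
      destruct (Nat.eqb_spec v 0) as [|_]; [tauto|].
      split; [intros [[z [-> H1]] H2]|intros [H1 H2]]; eauto.
    - assert (Huv : u <> v).
      { intros ->. apply (proj1 (Hsep l v Hv) Hin). constructor. }
      (* The only non-root source was [v], now separated from [u]; hence the root alone reaches the
         component of [u]. *)
      assert (Hru : forall a, conn (remove_edge (l, u, v) E) u a ->
                reachable (remove_edge (l, u, v) E) (eq 0) a).
      { intros a Ha. assert (Ha0 := conn_nonzero Hu Ha).
        apply reachable_mono with
          (S := fun x => x = 0 \/ (x = u /\ zero_or v u) \/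
                         (x = v /\ conn (remove_edge (l, u, v) E) u v)).
        - unfold zero_or. intros x [->|[[_ [H|H]]|[_ H]]]; try tauto.
          destruct (proj1 (Hsep l u Hu) Hin H).
        - apply reachable_split with (S := zero_or v); auto.
          + intros x Hx [H|H] Hc; [tauto|]. subst x. destruct (proj1 (Hsep l u Hu) Hin Hc).
          + apply Hr. apply conn_trans with u.
            * apply conn_bwd with l u; auto. constructor.
            * revert Ha. apply conn_incl, remove_edge_incl. }
      assert (HEu : walk_def true (comp_pred (remove_edge (l, u, v) E) u)).
      { apply IH; auto.
        - assert (Hl := remove_edge_length _ _ Hin). lia.
        - apply acyclic_remove_edge; auto.
        - intros a Ha. apply reachable_mono with (2 := Hru a Ha). intros x <-. left. auto.
        - apply reachable_incoming; auto. apply Hru. constructor. }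
      apply wd_ext with (2 := wd_and (wd_step l HEu) HE').
      intros F w x. rewrite (@comp_pred_split E v u l u v) by auto.
      destruct (Nat.eqb_spec u v) as [|_]; [tauto|].
      split; [intros [[z [H1 H2]] H3]|intros [H1 [z [H2 H3]]]]; eauto. }
  split; auto.
  destruct (classic (exists l c, In (l, c, v) E)) as [H|Hnin]; [apply wd_weaken; auto|].
  destruct (classic (exists l d, In (l, v, d) E)) as [[l [u Hin]]|Hnout].
  - destruct (Nat.eq_dec u 0) as [->|Hu].
    + apply wd_ext with (2 := wd_and (Hv' _ _ _ Hin (or_introl eq_refl))
                               (wd_dia l (wd_weaken (wd_root Lam)))).
      intros F w x. rewrite (@comp_pred_root_edge E v l v 0) by auto. simpl.
      destruct (Nat.eqb_spec v 0) as [|_]; [tauto|].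
      split; [intros [H1 [z [H2 ->]]]|intros [H1 H2]]; eauto.
    + assert (Hnc : ~ conn (remove_edge (l, v, u) E) v u).
      { intros H. apply (proj2 (Hsep l u Hu) Hin). apply conn_sym, H. }
      assert (HEu : walk_def false (comp_pred (remove_edge (l, v, u) E) u)).
      { apply IH; auto.
        - assert (Hl := remove_edge_length _ _ Hin). lia.
        - apply acyclic_remove_edge; auto.
        (* The deleted edge pointed to [u], which becomes the second source of its own component. *)
        - intros a Ha. assert (Ha0 := conn_nonzero Hu Ha).
          apply reachable_mono with
            (S := fun x => x = 0 \/ (x = u /\ zero_or v u) \/
                           (x = u /\ conn (remove_edge (l, v, u) E) u u)).
          + intros x Hx. unfold zero_or. tauto.
          + apply reachable_split with (S := zero_or v); auto.
            * intros x Hx [H|H] Hc; [tauto|]. subst x. destruct (proj2 (Hsep l u Hu) Hin Hc).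
            * apply Hr. apply conn_trans with u.
              -- apply conn_fwd with l u; auto. constructor.
              -- revert Ha. apply conn_incl, remove_edge_incl. }
      apply wd_ext with (2 := wd_and (Hv' _ _ _ Hin (or_intror (or_intror Hnc))) (wd_dia l HEu)).
      intros F w x. rewrite (@comp_pred_split E v u l v u) by auto.
      rewrite Nat.eqb_refl. tauto.
  - apply wd_ext with (2 := wd_top Lam). intros F w x. split; auto.
    intros _. apply comp_pred_nil; auto. intros l a b Hin.
    split; intros ->; [apply Hnout|apply Hnin]; eauto.
Qed.

(** * Gluing the components at the root *)

Definition embeds E (F : frame Lam) (w : W F) : Prop :=
  exists h : nat -> W F, h 0 = w /\ forall l a b, In (l, a, b) E -> R F l (h a) (h b).

(** The list [M] is there for induction, while [comp_pred] always refers to the whole of [E]. Two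
    root edges into one component each impose the full condition of that component. *)
Definition root_edges_pred E M (F : frame Lam) (w x : W F) : Prop :=
  forall l b, In (l, 0, b) M -> exists y, R F l x y /\
    (if b =? 0 then y = w else comp_pred E b F w y).

Lemma root_edges_pred_walk_def E M : acyclic E -> incl M E ->
  (forall l a b, In (l, a, b) E -> reachable E (eq 0) a) ->
  walk_def false (root_edges_pred E M).
Proof.
  intros Hac HM Hr. induction M as [|[[l a] b] M IH].
  - apply wd_ext with (2 := wd_top Lam). intros F w x. split; auto. intros _ l b [].
  - apply incl_cons_inv in HM. destruct HM as [Hin HM]. specialize (IH HM).
    destruct (Nat.eq_dec a 0) as [->|Ha].
    + assert (Hb : walk_def false (fun F w y => if b =? 0 then y = w else comp_pred E b F w y)).
      { destruct (Nat.eqb_spec b 0) as [->|Hb]; [apply wd_weaken, wd_root|].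
        apply (comp_pred_walk_def (n := length E)); auto. intros c Hc.
        apply reachable_mono with (S := eq 0); [intros x <-; left; auto|].
        assert (Hbr : reachable E (eq 0) b) by eauto using reachable.
        apply conn_sym in Hc.
        destruct Hc as [|l' u v z _ _ Hi _|l' u v z _ _ Hi _]; eauto using reachable. }
      apply wd_ext with (2 := wd_and (wd_dia l Hb) IH).
      intros F w x. split.
      * intros [H1 H2] l' b' [H|H]; [injection H as <- <-; auto|auto].
      * intros H. split; [apply (H l b); left; auto|]. intros l' b' H'. apply H. right. auto.
    + apply wd_ext with (2 := IH). intros F w x. split.
      * intros H l' b' [H'|H']; [congruence|auto].
      * intros H l' b' H'. apply H. right. auto.
Qed.

Lemma reachable_first E a : reachable E (eq 0) a -> a <> 0 ->
  exists l u, In (l, 0, u) E /\ u <> 0 /\ conn E u a.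
Proof.
  induction 1 as [a Ha|l a b _ IH Hin]; intros H0; [congruence|].
  destruct (Nat.eq_dec a 0) as [->|Ha].
  - exists l, b. split; auto. split; auto. constructor.
  - destruct (IH Ha) as [l' [u [H1 [H2 H3]]]]. exists l', u. split; auto. split; auto.
    apply conn_trans with a; auto. apply conn_fwd with l b; auto. constructor.
Qed.

Lemma embeds_iff E (F : frame Lam) (w : W F) :
  (forall l a b, In (l, a, b) E -> reachable E (eq 0) a) ->
  embeds E F w <-> root_edges_pred E E F w w.
Proof.
  intros Hr. split.
  - intros [h [H0 H]] l b Hin. exists (h b). split; [rewrite <- H0; auto|].
    destruct (Nat.eqb_spec b 0) as [->|Hb]; auto. exists h. auto.
  - intros H.
    assert (HM : forall M, incl M E -> exists h : nat -> W F, h 0 = w /\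
      forall l u, In (l, 0, u) M -> u <> 0 ->
      forall l' a b, In (l', a, b) E -> touches E u (l', a, b) -> R F l' (h a) (h b)).
    { induction M as [|[[l a] b] M IH]; intros HM.
      - exists (fun _ => w). split; auto. intros l u [].
      - apply incl_cons_inv in HM. destruct HM as [Hin HM].
        destruct (IH HM) as [h [H0 Hh]].
        destruct (classic (a = 0 /\ b <> 0)) as [[-> Hb]|Hab].
        + destruct (H l b Hin) as [y [_ Hy]].
          destruct (Nat.eqb_spec b 0) as [|_]; [tauto|].
          destruct Hy as [h' [H0' [_ Hh']]].
          (* [h'] respects all edges of the component of [b], including those already secured
             through another root edge into it; the other components keep [h]. *)
          exists (override E b h h'). split.
          { rewrite override_out; auto. intros Hc. apply (conn_nonzero Hb) in Hc. tauto. }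
          intros l1 u Hu Hu0 l2 c d Hcd Ht.
          destruct (classic (touches E b (l2, c, d))) as [Hbt|Hbt].
          * destruct (override_edge_in h h' Hb (eq_trans H0 (eq_sym H0')) Hcd Hbt) as [-> ->]. auto.
          * destruct (override_edge_out h h' Hb Hcd Hbt) as [-> ->].
            destruct Hu as [Hu|Hu]; [|eauto].
            injection Hu as -> ->. tauto.
        + exists h. split; auto. intros l1 u [Hu|Hu] Hu0; [|eauto].
          injection Hu as -> -> ->. tauto. }
    destruct (HM E (incl_refl E)) as [h [H0 Hh]]. exists h. split; auto.
    intros l a b Hin. destruct (Nat.eq_dec a 0) as [->|Ha].
    + destruct (Nat.eq_dec b 0) as [->|Hb].
      * destruct (H l 0 Hin) as [y [Hy ->]]. rewrite H0. exact Hy.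
      * apply (Hh l b Hin Hb); auto. right. split; auto. constructor.
    + destruct (reachable_first (Hr _ _ _ Hin) Ha) as [l' [u [H1 [H2 H3]]]].
      apply (Hh l' u H1 H2); auto. left. auto.
Qed.

(** * Reduced walks and undirected cycles *)

Definition source (s : edge * bool) : nat :=
  match fst s with (_, a, b) => if snd s then a else b end.
Definition target (s : edge * bool) : nat :=
  match fst s with (_, a, b) => if snd s then b else a end.
Definition backtracks (s t : edge * bool) : Prop := fst s = fst t /\ snd s <> snd t.

Inductive reduced_walk E : nat -> list (edge * bool) -> nat -> Prop :=
| rw_nil u : u <> 0 -> reduced_walk E u [] u
| rw_cons s p v : In (fst s) E -> source s <> 0 -> reduced_walk E (target s) p v ->
    (forall t q, p = t :: q -> ~ backtracks s t) -> reduced_walk E (source s) (s :: p) v.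

Lemma reduced_walk_incl E E' u p v : incl E E' -> reduced_walk E u p v -> reduced_walk E' u p v.
Proof. intros H. induction 1; constructor; auto. Qed.

(** As in free reduction, a step reversed by the first step of the walk cancels with it instead of
    being prepended. *)
Lemma reduced_walk_step E s p v : In (fst s) E -> source s <> 0 ->
  reduced_walk E (target s) p v -> exists q, reduced_walk E (source s) q v.
Proof.
  intros Hin Hs Hp.
  destruct (classic (exists t q, p = t :: q /\ backtracks s t)) as [[t [q [-> [Hb1 Hb2]]]]|Hn].
  - exists q. inversion Hp as [|? ? ? ? ? Hq]; subst.
    replace (source s) with (target t); auto.
    unfold source, target. rewrite <- Hb1. destruct (fst s) as [[l a] b].
    destruct (snd s), (snd t); congruence.
  - exists (s :: p). apply rw_cons; auto. intros t q -> Hb. apply Hn. eauto.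
Qed.

Lemma conn_reduced_walk E u v : u <> 0 -> conn E u v -> exists p, reduced_walk E u p v.
Proof.
  intros H0 H. induction H as [u|l u v z Hu Hv Hin _ IH|l u v z Hu Hv Hin _ IH].
  - exists []. constructor; auto.
  - destruct (IH Hv) as [p Hp]. apply (@reduced_walk_step E ((l, u, v), true) p z); auto.
  - destruct (IH Hv) as [p Hp]. apply (@reduced_walk_step E ((l, v, u), false) p z); auto.
Qed.

Definition walk_vertex (d : edge * bool) (u : nat) (p : list (edge * bool)) (i : nat) : nat :=
  match i with 0 => u | S j => target (nth j p d) end.

Lemma reduced_walk_spec E d u p v : reduced_walk E u p v ->
  walk_vertex d u p (length p) = v /\
  (forall i, i < length p -> In (fst (nth i p d)) E /\
     source (nth i p d) = walk_vertex d u p i) /\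
  (forall i, S i < length p -> ~ backtracks (nth i p d) (nth (S i) p d)) /\
  (forall i, i <= length p -> walk_vertex d u p i <> 0).
Proof.
  induction 1 as [u Hu|s p v Hin Hs Hp [IH1 [IH2 [IH3 IH4]]] Hb].
  - simpl. split; auto. split; [intros; lia|]. split; [intros; lia|].
    intros i Hi. replace i with 0 by lia. exact Hu.
  - assert (E1 : forall i, walk_vertex d (source s) (s :: p) (S i) = walk_vertex d (target s) p i)
      by (intros [|i]; reflexivity).
    simpl length. split; [|split; [|split]].
    + rewrite E1. auto.
    + intros [|i] Hi; [simpl; auto|]. rewrite E1. simpl. apply IH2. lia.
    + intros [|i] Hi; [|apply IH3; lia].
      destruct p as [|t q]; [simpl in Hi; lia|]. simpl. apply (Hb t q); auto.
    + intros [|i] Hi; [exact Hs|]. rewrite E1. apply IH4. lia.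
Qed.

Lemma cycles_acyclic (D : diagram Lam) : cycles_through_root D -> acyclic (dedges D).
Proof.
  intros H l u v Hu Hv Hin Hc.
  destruct (conn_reduced_walk Hu Hc) as [p Hp].
  (* This step closes the cycle by traversing the edge from [v] back to [u]. No backtracking occurs
     after it, because [p] avoids the edge. *)
  set (d := ((l, u, v), false)).
  assert (Hp' : reduced_walk (dedges D) v (d :: p) v).
  { apply (@rw_cons (dedges D) d p v); auto.
    - apply reduced_walk_incl with (2 := Hp). apply remove_edge_incl.
    - intros t q -> [Hb _]. inversion Hp as [|? ? ? Ht]; subst.
      apply in_remove_edge in Ht. simpl in Hb. apply (proj2 Ht). auto. }
  destruct (reduced_walk_spec d Hp') as [H1 [H2 [H3 H4]]].
  destruct (H (length (d :: p)) (walk_vertex d v (d :: p)) (fun i => nth i (d :: p) d)) as [i [Hi H0]].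
  - split; [simpl; lia|]. split; [exact H1|]. split; [|exact H3].
    intros i Hi. destruct (H2 i Hi) as [H5 H6]. split; [exact H5|].
    rewrite <- H6. unfold source, target, walk_vertex.
    unfold target. destruct (fst (nth i (d :: p) d)) as [[l' a] b].
    destruct (snd (nth i (d :: p) d)); auto.
  - apply (H4 i Hi H0).
Qed.

(** * The first-order formula of a diagram *)

Lemma fo_sat_exists (F : frame Lam) body ks : forall g : nat -> W F,
  fo_sat g (fold_right (fun i a => FEx i a) body ks) <->
  exists h, (forall k, ~ In k ks -> h k = g k) /\ fo_sat h body.
Proof.
  induction ks as [|i ks IH]; simpl; intros g.
  - split; [eauto|]. intros [h [H1 H2]].
    replace g with h; auto. apply functional_extensionality. auto.
  - split.
    + intros [d Hd]. apply IH in Hd. destruct Hd as [h [H1 H2]]. exists h. split; auto.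
      intros k Hk. rewrite H1 by tauto. unfold upd. destruct (Nat.eqb_spec k i); auto.
      subst. tauto.
    + intros [h [H1 H2]]. exists (h i). apply IH. exists h. split; auto.
      intros k Hk. unfold upd. destruct (Nat.eqb_spec k i); [subst; auto|]. apply H1.
      intros [Hi|Hi]; auto.
Qed.

Lemma fo_sat_edges (F : frame Lam) (g : nat -> W F) E :
  fo_sat g (fold_right (fun e a => match e with (l, i, j) => FAnd (FR l i j) a end) FTrue E) <->
  forall l a b, In (l, a, b) E -> R F l (g a) (g b).
Proof.
  induction E as [|[[l a] b] E IH]; simpl; [tauto|].
  rewrite IH. split.
  - intros [H1 H2] l' a' b' [H|H]; [injection H as <- <- <-; auto|auto].
  - intros H. split; auto.
Qed.

Lemma fo_sat_diag_formula (D : diagram Lam) (F : frame Lam) (g : nat -> W F) : diag_wf D ->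
  fo_sat g (diag_formula D) <-> embeds (dedges D) F (g 0).
Proof.
  intros Hwf. unfold diag_formula. rewrite fo_sat_exists. split.
  - intros [h [H1 H2]]. exists h. split.
    + apply H1. rewrite in_seq. lia.
    + apply fo_sat_edges, H2.
  (* Only [1] to [dn D] are quantified, so the assignment has to return to [g] above [dn D];
     well-formedness keeps all edges below that bound. *)
  - intros [h [H0 H]]. exists (fun k => if k <=? dn D then h k else g k). split.
    + intros k Hk. rewrite in_seq in Hk. destruct (Nat.leb_spec k (dn D)); auto.
      replace k with 0 by lia. auto.
    + apply fo_sat_edges. intros l a b Hin. destruct (Hwf l a b Hin) as [Ha Hb].
      apply Nat.leb_le in Ha, Hb. rewrite Ha, Hb. auto.
Qed.

Lemma diag_formula_sentence (D : diagram Lam) : diag_wf D -> sentence (FAll 0 (diag_formula D)).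
Proof.
  intros Hwf k. simpl. intros [Hk0 Hk]. unfold diag_formula in Hk.
  assert (H1 : ~ In k (seq 1 (dn D)) /\
    fv (fold_right (fun e a => match e with (l, i, j) => FAnd (FR l i j) a end) FTrue (dedges D)) k).
  { revert Hk. generalize (seq 1 (dn D)). intros ks.
    induction ks as [|i ks IH]; simpl; [tauto|]. intros [H1 H2]. apply IH in H2.
    intuition congruence. }
  destruct H1 as [H1 H2]. rewrite in_seq in H1.
  assert (H3 : exists l a b, In (l, a, b) (dedges D) /\ (k = a \/ k = b)).
  { clear -H2. induction (dedges D) as [|[[l a] b] E IH]; simpl in H2; [tauto|].
    destruct H2 as [H2|H2].
    - exists l, a, b. simpl. auto.
    - destruct (IH H2) as [l' [a' [b' [H3 H4]]]]. exists l', a', b'. simpl. auto. }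
  destruct H3 as [l [a [b [Hin H3]]]]. apply Hwf in Hin. lia.
Qed.

Lemma occurs_bounded (f : form Lam) : exists n, forall q, occurs q f -> q < n.
Proof.
  unfold occurs. induction f as [p| | |f [n H]|f [n H] g [m K]|f [n H] g [m K]|f [n H] g [m K]
    |l f [n H]|l f [n H]]; simpl;
    try solve [exists 0; intros q [[]|[]]];
    try solve [exists n; intros q Hq; apply H; tauto];
    try solve [exists (n + m); intros q Hq;
      assert (Hq' : q < n \/ q < m) by (specialize (H q); specialize (K q); tauto); lia].
  exists (S p). intros q [[_ ->]|[H _]]; [lia|discriminate].
Qed.
End Diagrams.

Lemma diagram_gen_sahlqvist (Lam : Type) (D : diagram Lam) :
  diag_wf D -> rooted D -> cycles_through_root D ->
  exists f, gen_sahlqvist f /\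
  (forall F w, valid_at F w f <-> embeds (dedges D) F w) /\
  (forall F (V : nat -> W F -> Prop), saturated V -> forall w,
     (forall s, sat V w (subst s f)) -> embeds (dedges D) F w).
Proof.
  intros Hwf Hroot Hcyc.
  assert (Hr : forall l a b, In (l, a, b) (dedges D) -> reachable (dedges D) (eq 0) a).
  { assert (Hreach : forall i, reach D i -> reachable (dedges D) (eq 0) i)
      by (induction 1; eauto using reachable).
    intros l a b Hin. apply Hreach, Hroot, (Hwf l a b Hin). }
  destruct (walk_def_gen_sahlqvist
    (root_edges_pred_walk_def (cycles_acyclic Hcyc) (incl_refl _) Hr)) as [f [H1 [H2 H3]]].
  exists f. split; [exact H1|]. split.
  - intros F w. rewrite H2. symmetry. apply embeds_iff, Hr.
  - intros F V HV w H. apply embeds_iff; auto. apply (H3 F V HV w H).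
Qed.

Theorem mainTheorem10 (Lam : Type) (D : diagram Lam)
  (Hwf : diag_wf D) (Hroot : rooted D) (Hcyc : cycles_through_root D) :
  let a := diag_formula D in
  let C : frame_class Lam := fun F => fo_valid F (FAll 0 a) in
  (* (I-i) *)   (exists f, gen_sahlqvist f /\ loc_def_by a f) /\
  (* (I-ii) *)  loc_definable a /\
  (* (I-iii) *) glob_definable (FAll 0 a) /\
  (* (I-iv) *)  (exists f, gen_sahlqvist f /\ axiomatises (fun g => g = f) (Log C)) /\
  (* (I-v) *)   (exists l : list (form Lam), axiomatises (fun g => In g l) (Log C)) /\
  (* (I-vi) *)  (exists (G : form Lam -> Prop) (n : nat),
                   (forall g q, G g -> occurs q g -> q < n) /\ axiomatises G (Log C)) /\
  (* (I-vii) *) (exists G : form Lam -> Prop,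
                   (forall g, G g -> canonical g) /\ axiomatises G (Log C)) /\
  (* (I-viii) *) (exists (f : form Lam) (G : form Lam -> Prop),
                   (forall g, G g -> canonical g) /\
                   axiomatises (fun g => g = f \/ G g) (Log C)) /\
  (* (I-ix) *)  (forall F : frame Lam, validates F (Log C) <-> C F) /\
  (* (I-x) *)   (exists s : fo Lam, sentence s /\
                   forall F : frame Lam, validates F (Log C) <-> fo_valid F s).
Proof.
  intros a C.
  destruct (diagram_gen_sahlqvist Hwf Hroot Hcyc) as [f [Hgs [Hloc Hcan]]].
  assert (HC : forall F : frame Lam, C F <-> forall w, embeds (dedges D) F w).
  { intros F. unfold C, fo_valid. simpl. split.
    - intros H w. specialize (H (fun _ => w) w).
      apply (fo_sat_diag_formula _ _ Hwf) in H. exact H.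
    - intros H g d. apply fo_sat_diag_formula; auto. }
  assert (HCf : forall F : frame Lam, C F <-> frame_valid F f).
  { intros F. rewrite HC. split; intros H w; apply Hloc, H. }
  assert (Hdef : loc_def_by a f).
  { intros F w. rewrite Hloc. split.
    - intros H g <-. apply fo_sat_diag_formula; auto.
    - intros H. specialize (H (fun _ => w) eq_refl).
      apply (fo_sat_diag_formula _ _ Hwf) in H. exact H. }
  (* Closure of the logic under substitution makes all instances of [f] true in the canonical model,
     which is the premise of [Hcan]. *)
  assert (Hframe : forall G : form Lam -> Prop, G f -> C (canonical_frame (Deriv G))).
  { intros G HG. apply HC. intros w. apply (Hcan _ _ (canonical_saturated Lam G)).
    intros s. apply canonical_theorem, d_sub, d_ax, HG. }
  (* [G] is only required to have [f] as its sole member, so presentations by equality, by a list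
     and by a disjunction are covered at once. *)
  assert (Hax : forall G : form Lam -> Prop, G f -> (forall g, G g -> g = f) ->
            axiomatises G (Log C)).
  { intros G HG HGf g. split.
    - intros Hg. apply canonical_complete. intros S. apply (Hg _ (Hframe G HG)).
    - intros Hg F HF. revert g Hg. apply soundness. intros g Hg. apply HGf in Hg. subst g.
      apply HCf, HF. }
  assert (Hcanon : canonical f) by (apply HCf, Hframe; reflexivity).
  assert (Hlog : forall F : frame Lam, validates F (Log C) <-> C F).
  { intros F. split.
    - intros H. apply HCf, H. intros F' HF'. apply HCf, HF'.
    - intros HF g Hg. apply Hg, HF. }
  split; [|split; [|split; [|split; [|split; [|split; [|split; [|split; [|split]]]]]]]].
  - exists f. auto.
  - exists f. exact Hdef.
  - exists f. intros F. symmetry. apply HCf.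
  - exists f. split; auto.
  - exists [f]. apply Hax; simpl; intuition.
  - destruct (occurs_bounded f) as [n Hn]. exists (fun g => g = f), n. split; auto.
    intros g q ->. apply Hn.
  - exists (fun g => g = f). split; auto. intros g ->. exact Hcanon.
  - exists f, (fun g => g = f). split; [intros g ->; exact Hcanon|].
    apply Hax; auto. intros g [H|H]; exact H.
  - exact Hlog.
  - exists (FAll 0 a). split; [apply diag_formula_sentence, Hwf|exact Hlog].
Qed.
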